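(* Let $\omega$ be an $RVT$ code of length $k$ (for the $\mathbb{R}^3$-Monster Tower) whose $k$-th (last) letter is $L_2$, $L_3$ or $T_2$ and is the first occurrence of that letter in $\omega$, and let $p_k\in\mathcal{P}^k$ be a point with $RVT$ code $\omega$. Then the incidence relations between the critical planes in $\Delta_k(p_k)$ are determined as follows. If the last letter is $L_2$ or $L_3$, the critical planes in $\Delta_k(p_k)$ are $V$, $T_1$ and $T_2$. If the last letter is $T_2$, the critical planes in $\Delta_k(p_k)$ are $V$ and $T_2$ (there is no $T_1$). The tangency planes are given by the following list, in which each code has total length $k$, $\omega'$ is an undetermined block of $r$ letters, $T=T_1$ and $L=L_1$. Last letter $L_2$: - $R\omega' VT^mLL_2$, $m\ge0$: $T_1=\delta^{2}_{m+2+r}(p_{m+r+4})$, $T_2=\delta^{m+3}_{1+r}(p_{m+r+4})$. - $R\omega' LLL_2$: $T_1=\delta^2_{k-2}(p_k)$, $T_2=\delta^3_{k-3}(p_k)$. Last letter $L_3$ (in all these cases $T_1=\delta^1_{k-1}(p_k)$): - $R\omega' VT^mLL_3$, $m\ge0$: $T_2=\delta^{m+3}_{r+1}(p_{r+m+4})$. - $R\omega' LLL_3$: $T_2=\delta^3_{k-3}(p_k)$. - $R\omega' VT^mLT_2L_3$, $m\ge0$: $T_2=\delta^{m+4}_{r+1}(p_{m+r+5})$. - $R\omega' LLT_2L_3$: $T_2=\delta^4_{k-4}(p_k)$. - $R\omega' VT^mLL_2T_2L_3$, $m\ge0$: $T_2=\delta^{4}_{m+r+2}(p_{m+r+6})$.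 - $R\omega' VT^mL^sL_2T_2L_3$, $m\ge0$, $s\ge2$: $T_2=\delta^{4}_{m+r+2}(p_{m+r+6})$. Last letter $T_2$ (in all these cases there is no $T_1$): - $R\omega' VT^mLT_2$, $m\ge0$: $T_2=\delta^{m+3}_{1+r}(p_{m+r+4})$. - $R\omega' LLT_2$: $T_2=\delta^3_{k-3}(p_k)$. - $R\omega' VT^mLL_2T_2$, $m\ge0$: $T_2=\delta^{m+4}_{r+1}(p_{m+r+5})$. - $R\omega' VT^mL^sL_2T_2$, $m\ge0$, $s\ge2$: $T_2=\delta^4_{r+m+s}(p_{m+s+r+4})$. - $R\omega' VT^mLL_3T_2$, $m\ge0$: $T_2=\delta^{m+4}_{r+1}(p_{m+r+5})$. - $R\omega' VT^mL^sL_3T_2$, $m\ge0$, $s\ge2$: $T_2=\delta^3_{m+s+r}(p_{m+s+r+3})$.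
   Context: **Monster Tower.** For a manifold $Z$ with a distribution (constant rank subbundle of $TZ$) $\Delta$ of rank $\rho$, let $Z^1=\mathbb{P}(\Delta)$ be the manifold of pairs $(p,\ell)$ with $p\in Z$ and $\ell\subset\Delta(p)$ a line, and $\pi(p,\ell)=p$. Its Cartan prolongation is the rank $\rho$ distribution $\Delta^1(p,\ell)=d\pi_{(p,\ell)}^{-1}(\ell)$. Starting with $\mathcal{P}^0=\mathbb{R}^3$, $\Delta_0=T\mathbb{R}^3$, put $\mathcal{P}^{k}=\mathbb{P}(\Delta_{k-1})$ and $\Delta_k=(\Delta_{k-1})^1$. All $\Delta_k$ have rank 3. The $\mathbb{R}^3$-Monster Tower is the sequence $(\mathcal{P}^k,\Delta_k)$ with projections $\pi_{k,i}:\mathcal{P}^k\to\mathcal{P}^i$. Given $p_k\in\mathcal{P}^k$, write $p_i=\pi_{k,i}(p_k)$, so that $p_i=(p_{i-1},\ell_{i-1})$ with $\ell_{i-1}\subset\Delta_{i-1}(p_{i-1})$. **Baby Monsters and critical planes.** For $i\ge1$ let $F_i(p_i)=\pi_{i,i-1}^{-1}(p_{i-1})\subset\mathcal{P}^i$ be the (2-dimensional) fiber through $p_i$; it is an integral submanifold of $\Delta_i$. Iterating prolongation starting from $(F_i(p_i),TF_i(p_i))$ gives submanifolds $\mathcal{P}^j(F_i(p_i))\subset\mathcal{P}^{i+j}$, $j\ge0$, with rank 2 distributions $\delta_i^j$, $\delta_i^j(q)=\Delta_{i+j}(q)\cap T_q\mathcal{P}^j(F_i(p_i))\subset\Delta_{i+j}(q)$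 for $q\in\mathcal{P}^j(F_i(p_i))$. This subtower is called a Baby Monster born at level $i$, and each such $\delta_i^j(q)$ is called a critical plane (born at level $i$) in $\Delta_{i+j}(q)$. For $k\ge 1$ the vertical plane $V(p_k)=\delta^0_k(p_k)=T_{p_k}F_k(p_k)$ is always a critical plane in $\Delta_k(p_k)$. **Kumpera-Rubin (KR) coordinates.** Fix $p_k\in\mathcal{P}^k$. Let $(f_0,u_0,v_0)=(x,y,z)$ be the coordinates on $\mathbb{R}^3$. Inductively, near $p_i$ the distribution $\Delta_i$ is coframed by the restrictions of $df_i,du_i,dv_i$. Given $p_{i+1}=(p_i,\ell_i)$, let $f_{i+1}$ be the first function in the ordered list $(f_i,u_i,v_i)$ whose differential does not vanish on $\ell_i$, let $g,h$ be the remaining two functions in the order of the list, and let $u_{i+1}=dg/df_{i+1}$, $v_{i+1}=dh/df_{i+1}$ be the corresponding affine fiber coordinates on $\mathbb{P}(\Delta_i)$ near $p_{i+1}$. Then $V(p_k)=\{df_k=0\}$ in $\Delta_k(p_k)$, for $k\ge1$. **Planes $T_1,T_2$ and lines $L_1,L_2,L_3$.** In $\Delta_k(p_k)$, $k\ge1$: $T_1$ denotes the critical plane different from $V$ given by $du_k=0$, if this plane is critical; $T_2$ denotes the critical plane different from $V$ given by $dv_k=0$, if this plane is critical. Whenever the planes involved are present, $L_1=V\cap T_1$, $L_2=T_1\cap T_2$, $L_3=V\cap T_2$. The letters $T$ and $L$ without index mean $T_1$ and $L_1$; $T^m$ and $L^s$ denote $m$-fold and $s$-fold repetition of a letter. **$RVT$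 code.** A line $\ell\subset\Delta_k(p_k)$, $k\ge1$, is a critical direction if there is an immersed integral curve of $\Delta_k$ through $p_k$ tangent to $\ell$ at $p_k$ whose projection to $\mathcal{P}^0$ is constant; otherwise it is a regular direction. The $RVT$ code of $p_k$ is the word $\omega_1\cdots\omega_k$, where $\omega_1=R$ and, for $2\le i\le k$: $\omega_i=R$ if $\ell_{i-1}$ is a regular direction; if $\ell_{i-1}$ is critical, $\omega_i=L_j$ if $\ell_{i-1}$ is the line $L_j$ in $\Delta_{i-1}(p_{i-1})$, and otherwise $\omega_i$ is whichever of $V,T_1,T_2$ is the critical plane in $\Delta_{i-1}(p_{i-1})$ containing $\ell_{i-1}$. An $RVT$ code of length $k$ is a word that is the $RVT$ code of some point of $\mathcal{P}^k$.
   Formalization: Three misprinted T_2 entries are corrected: for VT^mLL_2T_2L_3, T_2=δ^{m+5}_{r+1}(p_k); for VT^mL^sL_2T_2L_3, T_2=δ^5_{m+r+s}(p_k); for VT^mL^sL_3T_2, T_2=δ^4_{m+s+r}(p_k). The list is read as implications, not as exhaustive. *)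

(* Defs.v *)
From HB Require Import structures.
From mathcomp Require Import all_boot all_order all_algebra.
From mathcomp Require Import all_classical all_reals all_analysis.

Set Implicit Arguments.
Unset Strict Implicit.
Unset Printing Implicit Defensive.

Import Order.TTheory GRing.Theory Num.Theory.
Import numFieldNormedType.Exports.

Local Open Scope classical_set_scope.
Local Open Scope ring_scope.

(* Every manifold Z below is an embedded submanifold of some R^n, written as
   the set of its points; T_p Z is a set of vectors of R^n, and a distribution
   assigns to every point p of Z a set of vectors of R^n. *)

Definition smooth (R : realType) (n : nat) (c : R -> 'rV[R]_n) : Prop :=
  forall (m : nat) (t : R), derivable (derive1n m c) t 1.

Definition curve_in (R : realType) (n : nat) (Z : set 'rV[R]_n)
    (c : R -> 'rV[R]_n) : Prop :=
  smooth c /\ forall t, Z (c t).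

Definition tangent (R : realType) (n : nat) (Z : set 'rV[R]_n)
    (p : 'rV[R]_n) : set 'rV[R]_n :=
  [set X | exists c : R -> 'rV[R]_n,
     [/\ curve_in Z c, c 0 = p & derive1 c 0 = X]].

(* dg_p(X), X in T_p Z, for a function g whose values off Z, or on Z away from
   p, are irrelevant.  The derivative does not depend on the curve as soon as g
   is differentiable on Z near p. *)
Definition differential_on (R : realType) (n : nat) (Z : set 'rV[R]_n)
    (g : 'rV[R]_n -> R) (p X : 'rV[R]_n) : R :=
  xget 0 [set a : R | exists c : R -> 'rV[R]_n,
    [/\ curve_in Z c, c 0 = p, derive1 c 0 = X & is_derive (0 : R) 1 (g \o c) a]].

Record dist_manifold (R : realType) (n : nat) := DistManifold {
  carrier : set 'rV[R]_n ;
  distr : 'rV[R]_n -> set 'rV[R]_n }.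

(* Real projective space is embedded in the n x n matrices by sending a line to
   the orthogonal projection onto it.  A pair (p, l) with l a line of R^n is
   thus the vector (p, projection onto l) of R^(n + n * n), and the
   projection pi(p, l) = p is the linear map lsubmx, its own differential. *)
Definition line_proj (R : realType) (n : nat) (w : 'rV[R]_n) : 'M[R]_n :=
  ((w *m w^T) 0 0)^-1 *: (w^T *m w).

Definition pair_line (R : realType) (n : nat) (p w : 'rV[R]_n) :
    'rV[R]_(n + n * n) :=
  row_mx p (mxvec (line_proj w)).

Definition base_pt (R : realType) (n : nat) (q : 'rV[R]_(n + n * n)) :
    'rV[R]_n := lsubmx q.

Definition line_of (R : realType) (n : nat) (q : 'rV[R]_(n + n * n)) :
    set 'rV[R]_n :=
  [set v | (v <= (vec_mx (rsubmx q) : 'M[R]_n))%MS].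

Definition prolong (R : realType) (n : nat) (D : dist_manifold R n) :
    dist_manifold R (n + n * n) :=
  let Z1 := [set q | exists p w : 'rV[R]_n,
    [/\ carrier D p, distr D p w, w != 0 & q = pair_line p w]] in
  DistManifold Z1
    (fun q => [set X | tangent Z1 q X /\ line_of q (base_pt X)]).

Fixpoint mdim (k : nat) : nat :=
  if k is k'.+1 then (mdim k' + mdim k' * mdim k')%N else 3.

Notation mpoint R k := 'rV[R]_(mdim k).

Fixpoint monster (R : realType) (k : nat) : dist_manifold R (mdim k) :=
  match k return dist_manifold R (mdim k) with
  | 0 => DistManifold setT (fun _ => setT)
  | k'.+1 => prolong (monster R k')
  end.

Fixpoint to_level0 (R : realType) (k : nat) : mpoint R k -> mpoint R 0 :=
  match k return mpoint R k -> mpoint R 0 with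
  | 0 => id
  | k'.+1 => fun p => to_level0 (base_pt p)
  end.

Definition fiber (R : realType) (k : nat) (p : mpoint R k.+1) :
    set (mpoint R k.+1) :=
  [set q | carrier (monster R k.+1) q /\ base_pt q = base_pt p].

(* For 1 <= i <= k, baby i p is P^(k - i)(F_i(p_i)) inside P^k, where p_i is
   the projection of p to level i; its distribution is delta_i^(k - i).  For
   other i the carrier is empty. *)
Fixpoint baby (R : realType) (i k : nat) :
    mpoint R k -> dist_manifold R (mdim k) :=
  match k return mpoint R k -> dist_manifold R (mdim k) with
  | 0 => fun _ => DistManifold set0 (fun _ => set0)
  | k'.+1 => fun p =>
      if k'.+1 == i then DistManifold (fiber p) (tangent (fiber p))
      else prolong (baby i (base_pt p))
  end.

(* W = delta_i^j(p); the equation records that delta_i^j lives at level i + j. *)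
Definition is_delta (R : realType) (k : nat) (p : mpoint R k) (i j : nat)
    (W : set (mpoint R k)) : Prop :=
  [/\ (0 < i)%N, (i + j)%N = k, carrier (baby i p) p & W = distr (baby i p) p].

Definition critical_plane (R : realType) (k : nat) (p : mpoint R k)
    (W : set (mpoint R k)) : Prop :=
  exists i j : nat, is_delta p i j W.

Definition vertical (R : realType) (k : nat) (p : mpoint R k) :
    set (mpoint R k) := distr (baby k p) p.

(* The function dg / df on P(Delta_k): the ratio of the restrictions of dg
   and df to the line of q.  It is unique where df does not vanish on that line;
   elsewhere the value is irrelevant. *)
Definition ratio (R : realType) (k : nat) (g f : mpoint R k -> R) :
    mpoint R k.+1 -> R := fun q =>
  xget 0 [set a : R | forall w, line_of q w ->
    differential_on (carrier (monster R k)) g (base_pt q) w =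
    a * differential_on (carrier (monster R k)) f (base_pt q) w].

(* The functions (f_k, u_k, v_k) of the Kumpera-Rubin coordinates attached to
   the point p, meaningful near p. *)
Fixpoint KR (R : realType) (k : nat) : mpoint R k ->
    (mpoint R k -> R) * (mpoint R k -> R) * (mpoint R k -> R) :=
  match k return mpoint R k ->
    (mpoint R k -> R) * (mpoint R k -> R) * (mpoint R k -> R) with
  | 0 => fun _ =>
      (fun q : mpoint R 0 => q 0 (inord 0 : 'I_3),
       fun q : mpoint R 0 => q 0 (inord 1 : 'I_3),
       fun q : mpoint R 0 => q 0 (inord 2 : 'I_3))
  | k'.+1 => fun p =>
      let: (f, u, v) := KR (base_pt p) in
      let nonzero_on_line (g : mpoint R k' -> R) := `[< exists2 w, line_of p w &
        differential_on (carrier (monster R k')) g (base_pt p) w != 0 >] in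
      let: (f', g, h) :=
        if nonzero_on_line f then (f, u, v)
        else if nonzero_on_line u then (u, f, v)
        else (v, f, u) in
      (f' \o (fun q : mpoint R k'.+1 => base_pt q), ratio g f', ratio h f')
  end.

Definition KR_u (R : realType) (k : nat) (p : mpoint R k) : mpoint R k -> R :=
  (KR p).1.2.

Definition KR_v (R : realType) (k : nat) (p : mpoint R k) : mpoint R k -> R :=
  (KR p).2.

Definition kernel_plane (R : realType) (k : nat) (p : mpoint R k)
    (g : mpoint R k -> R) : set (mpoint R k) :=
  [set X | distr (monster R k) p X /\
           differential_on (carrier (monster R k)) g p X = 0].

Definition is_T1 (R : realType) (k : nat) (p : mpoint R k)
    (W : set (mpoint R k)) : Prop :=
  [/\ critical_plane p W, W <> vertical p & W = kernel_plane p (KR_u p)].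

Definition is_T2 (R : realType) (k : nat) (p : mpoint R k)
    (W : set (mpoint R k)) : Prop :=
  [/\ critical_plane p W, W <> vertical p & W = kernel_plane p (KR_v p)].

Definition is_L1 (R : realType) (k : nat) (p : mpoint R k)
    (l : set (mpoint R k)) : Prop :=
  exists2 T, is_T1 p T & l = vertical p `&` T.

Definition is_L2 (R : realType) (k : nat) (p : mpoint R k)
    (l : set (mpoint R k)) : Prop :=
  exists T T', [/\ is_T1 p T, is_T2 p T' & l = T `&` T'].

Definition is_L3 (R : realType) (k : nat) (p : mpoint R k)
    (l : set (mpoint R k)) : Prop :=
  exists2 T, is_T2 p T & l = vertical p `&` T.

Definition critical_direction (R : realType) (k : nat) (p : mpoint R k)
    (l : set (mpoint R k)) : Prop :=
  exists c : R -> mpoint R k,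
    [/\ curve_in (carrier (monster R k)) c,
        forall t, distr (monster R k) (c t) (derive1 c t) /\ derive1 c t != 0,
        c 0 = p,
        l (derive1 c 0) &
        forall t, to_level0 (c t) = to_level0 p].

Inductive letter := lR | lV | lT1 | lT2 | lL1 | lL2 | lL3.

Definition letter_code (a : letter) : 'I_7 :=
  inord (match a with
  | lR => 0 | lV => 1 | lT1 => 2 | lT2 => 3 | lL1 => 4 | lL2 => 5 | lL3 => 6
  end).

Definition letter_decode (i : 'I_7) : letter :=
  nth lR [:: lR; lV; lT1; lT2; lL1; lL2; lL3] i.

Lemma letter_codeK : cancel letter_code letter_decode.
Proof. by case; rewrite /letter_decode inordK. Qed.

HB.instance Definition _ := Equality.copy letter (can_type letter_codeK).

Definition letter_at (R : realType) (k : nat) (p : mpoint R k)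
    (l : set (mpoint R k)) (a : letter) : Prop :=
  let in_plane P := [/\ critical_direction p l,
    ~ (is_L1 p l \/ is_L2 p l \/ is_L3 p l) & P] in
  match a with
  | lR => ~ critical_direction p l
  | lL1 => critical_direction p l /\ is_L1 p l
  | lL2 => critical_direction p l /\ is_L2 p l
  | lL3 => critical_direction p l /\ is_L3 p l
  | lV => in_plane (l `<=` vertical p)
  | lT1 => in_plane (exists2 T, is_T1 p T & l `<=` T)
  | lT2 => in_plane (exists2 T, is_T2 p T & l `<=` T)
  end.

Fixpoint RVT_code (R : realType) (k : nat) : mpoint R k -> seq letter -> Prop :=
  match k return mpoint R k -> seq letter -> Prop with
  | 0 => fun _ w => w = [::]
  | k'.+1 => fun p w => exists w' a,
      [/\ w = rcons w' a, RVT_code (base_pt p) w' &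
          if k' is 0 then a = lR
          else letter_at (base_pt p) (line_of p) a]
  end.

(* T_1 is present in Delta_k(p) and T_1 = delta_i^j(p). *)
Definition T1_eq (R : realType) (k : nat) (p : mpoint R k) (i j : nat) : Prop :=
  exists2 W, is_T1 p W & is_delta p i j W.

Definition T2_eq (R : realType) (k : nat) (p : mpoint R k) (i j : nat) : Prop :=
  exists2 W, is_T2 p W & is_delta p i j W.

(* Main.v *)
(* The point of the proof is that Kumpera-Rubin charts linearize everything.  A
   chart sends the coordinates (x, y, z, u_1, v_1, ..., u_k, v_k) to a point of
   P^k; it is built so that Delta_k has a frame dual to (df_k, du_k, dv_k), and
   every curve of P^k through a point of the chart is, after a change of
   parameter, the image of a smooth curve of coordinates.  In a chart a baby
   monster is therefore a coordinate subspace, and each of its planes is the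
   kernel of exactly one of df_k, du_k, dv_k.  At birth this is df_k, the vertical
   plane.  When the line l_k lies in the plane, the plane prolongs as follows:
   {df_k = 0} becomes T_1, {dv_k = 0} becomes T_2, and {du_k = 0} becomes T_1 or
   T_2 according to whether df_k is nonzero on l_k or not.  So Delta_k contains at
   most one T_1 and one T_2, and reading the code letter by letter gives the levels
   at which they are born; the letters R never matter for this. *)

(* Smoothness, tangent vectors and differentials are given only through curves defined on all of
   [R], so the charts are controlled by hand, in two ways. Their components are rational with
   denominators that never vanish; this class is closed under directional derivatives, which matters
   because the chart of level k + 1 contains a derivative of the chart of level k. Conversely, a
   curve in the tower must be lifted to smooth coordinates. Its line is seen only through a
   projection matrix, so a spanning vector is obtained by projecting one fixed vector, and its
   components on the frame are extracted with a Gram matrix. The fiber coordinates are quotients by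
   the pivot component, which is known to be nonzero only near 0; squeezing the parameter into a
   small interval removes this obstacle without changing the velocity at 0. Saying which planes are
   absent needs the reverse of prolongation: a critical plane that is not vertical comes from a
   critical plane one level lower that contains the line of the point. *)
Require Import Defs.
From HB Require Import structures.
From mathcomp Require Import all_boot all_order all_algebra.
From mathcomp Require Import all_classical all_reals all_analysis.
From mathcomp Require Import ring zify.

Set Implicit Arguments.
Unset Strict Implicit.
Unset Printing Implicit Defensive.

Import Order.TTheory GRing.Theory Num.Theory.
Import numFieldNormedType.Exports.

Local Open Scope nat_scope.

(** * Smooth functions of one variable *)

Section SmoothReal.
Local Open Scope classical_set_scope.
Local Open Scope ring_scope.
Context {R : realType}.
Implicit Types (f g h : R -> R) (t a b : R).

(* A record, so that implicit arguments are not computed through [derivable]. *)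
Record smooth1 f : Prop :=
  Smooth1 { smooth1_derivable : forall m t, derivable (derive1n m f) t 1 }.
Arguments smooth1_derivable {f} _ m t.

(** The recursion passes to [derive1 f], whereas [derive1n] differentiates on the outside; this is
    what lets the product, inverse and chain rules be proved by induction on [n]. *)
Fixpoint Cn (n : nat) f : Prop :=
  (forall t, derivable f t 1) /\ (if n is m.+1 then Cn m (derive1 f) else True).

Lemma smooth1P f : smooth1 f <-> forall n, Cn n f.
Proof.
split=> [[sf] n|Cf]; last constructor=> m.
  elim: n f sf => [|n IHn] f sf /=; split=> //; do ?exact: (sf 0%N).
  by apply: IHn => m t; rewrite -derive1Sn; apply: sf.
elim: m f Cf => [|m IHm] f Cf t; first by have [+ _] := Cf 0%N; apply.
by rewrite derive1Sn; apply: IHm => n; have [] := Cf n.+1.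
Qed.

Lemma Cn_der n f t : Cn n f -> derivable f t 1.
Proof. by case: n => [|n] []. Qed.

Lemma CnW n f : Cn n.+1 f -> Cn n f.
Proof.
elim: n f => [|n IHn] f [df Cf]; first by split.
by split=> //; exact: IHn.
Qed.

Lemma is_derive1E f t a : is_derive t 1 f a -> derive1 f t = a.
Proof. by move=> fa; rewrite derive1E derive_val. Qed.

Lemma derivable_is_derive f t : derivable f t 1 -> is_derive t 1 f (derive1 f t).
Proof. by move=> /derivableP; rewrite derive1E. Qed.

Lemma is_derive_add f g t a b : is_derive t 1 f a -> is_derive t 1 g b ->
  is_derive t 1 (fun s => f s + g s) (a + b).
Proof. by move=> fa gb; apply: is_deriveD. Qed.

Lemma is_derive_mul f g t a b : is_derive t 1 f a -> is_derive t 1 g b ->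
  is_derive t 1 (fun s => f s * g s) (a * g t + f t * b).
Proof.
move=> fa gb; apply: is_derive_eq (is_deriveM fa gb) _.
by rewrite addrC [g t *: a]mulrC.
Qed.

Lemma is_derive_inv f t a : f t != 0 -> is_derive t 1 f a ->
  is_derive t 1 (fun s => (f s)^-1) (- a * ((f t)^-1 * (f t)^-1)).
Proof.
move=> ft0 fa; apply: is_derive_eq (is_deriveV ft0 fa) _.
by rewrite /GRing.scale /= expr2 invfM mulNr [RHS]mulNr mulrC.
Qed.

Lemma Cn_cst n (a : R) : Cn n (fun=> a).
Proof.
elim: n a => [|n IHn] a; split=> //; do ?by move=> t; apply: derivable_cst.
suff -> : derive1 (fun=> a : R) = (fun=> 0) by exact: IHn.
by apply/funext => t; exact: is_derive1E.
Qed.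

Lemma Cn_id n : Cn n (fun t : R => t).
Proof.
case: n => [|n]; split=> //; do ?by move=> t; apply: derivable_id.
suff -> : derive1 (fun t : R => t) = (fun=> 1) by exact: Cn_cst.
by apply/funext => t; exact: is_derive1E.
Qed.

Lemma Cn_add n f g : Cn n f -> Cn n g -> Cn n (fun t => f t + g t).
Proof.
elim: n f g => [|n IHn] f g Cf Cg; split=> //.
- by move=> t; have [] := @is_derive_add f g t _ _ (derivable_is_derive (Cn_der Cf))
    (derivable_is_derive (Cn_der Cg)).
- by move=> t; have [] := @is_derive_add f g t _ _ (derivable_is_derive (Cn_der Cf))
    (derivable_is_derive (Cn_der Cg)).
have -> : derive1 (fun t => f t + g t) = (fun t => derive1 f t + derive1 g t).
  apply/funext => t; apply/is_derive1E.
  by apply: is_derive_add; apply/derivable_is_derive; [case: Cf|case: Cg].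
by apply: IHn; [case: Cf|case: Cg].
Qed.

Lemma Cn_mul n f g : Cn n f -> Cn n g -> Cn n (fun t => f t * g t).
Proof.
elim: n f g => [|n IHn] f g Cf Cg; split=> //.
- by move=> t; have [] := @is_derive_mul f g t _ _ (derivable_is_derive (Cn_der Cf))
    (derivable_is_derive (Cn_der Cg)).
- by move=> t; have [] := @is_derive_mul f g t _ _ (derivable_is_derive (Cn_der Cf))
    (derivable_is_derive (Cn_der Cg)).
have -> : derive1 (fun t => f t * g t) =
    (fun t => derive1 f t * g t + f t * derive1 g t).
  apply/funext => t; apply/is_derive1E.
  by apply: is_derive_mul; apply/derivable_is_derive; [case: Cf|case: Cg].
by apply: Cn_add; apply: IHn; (do ?exact: CnW); [case: Cf|case: Cg].
Qed.

(** The derivative of 1/f is a product of f' and two copies of 1/f, so the induction on the order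
    keeps [f] fixed. *)
Lemma Cn_inv n f : (forall t, f t != 0) -> Cn n f -> Cn n (fun t => (f t)^-1).
Proof.
move=> f0; elim: n => [|n IHn] Cf; split=> //.
- by move=> t; have [] := @is_derive_inv f t _ (f0 t) (derivable_is_derive (Cn_der Cf)).
- by move=> t; have [] := @is_derive_inv f t _ (f0 t) (derivable_is_derive (Cn_der Cf)).
have -> : derive1 (fun t => (f t)^-1) =
    (fun t => (-1 * derive1 f t) * ((f t)^-1 * (f t)^-1)).
  apply/funext => t; apply/is_derive1E; rewrite mulN1r.
  by apply: is_derive_inv => //; apply/derivable_is_derive; case: Cf.
have Ci := IHn (CnW Cf).
by do ![apply: Cn_mul => //]; [exact: Cn_cst|case: Cf].
Qed.

Lemma Cn_comp n f g : Cn n f -> Cn n g -> Cn n (fun t => f (g t)).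
Proof.
have comp t h1 h2 : derivable h1 (h2 t) 1 -> derivable h2 t 1 ->
    is_derive t 1 (fun t => h1 (h2 t)) (derive1 h1 (h2 t) * derive1 h2 t).
  by move=> d1 d2; apply: is_derive1_comp; apply/derivable_is_derive.
elim: n f g => [|n IHn] f g Cf Cg; split=> //.
- by move=> t; have [] := comp t f g (Cn_der Cf) (Cn_der Cg).
- by move=> t; have [] := comp t f g (Cn_der Cf) (Cn_der Cg).
have -> : derive1 (fun t => f (g t)) = (fun t => derive1 f (g t) * derive1 g t).
  apply/funext => t; apply/is_derive1E/comp; [exact: Cn_der Cf|exact: Cn_der Cg].
by apply: Cn_mul; [apply: IHn; [case: Cf|exact: CnW]|case: Cg].
Qed.

Lemma smooth1_cst (a : R) : smooth1 (fun=> a).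
Proof. by apply/smooth1P => n; exact: Cn_cst. Qed.

Lemma smooth1_id : smooth1 (fun t => t).
Proof. by apply/smooth1P => n; exact: Cn_id. Qed.

Lemma smooth1_add f g : smooth1 f -> smooth1 g -> smooth1 (fun t => f t + g t).
Proof. by rewrite !smooth1P => sf sg n; exact: Cn_add. Qed.

Lemma smooth1_mul f g : smooth1 f -> smooth1 g -> smooth1 (fun t => f t * g t).
Proof. by rewrite !smooth1P => sf sg n; exact: Cn_mul. Qed.

Lemma smooth1_inv f : (forall t, f t != 0) -> smooth1 f ->
  smooth1 (fun t => (f t)^-1).
Proof. by rewrite !smooth1P => f0 sf n; exact: Cn_inv. Qed.

Lemma smooth1_comp f g : smooth1 f -> smooth1 g -> smooth1 (fun t => f (g t)).
Proof. by rewrite !smooth1P => sf sg n; exact: Cn_comp. Qed.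

Lemma smooth1_is_derive f t : smooth1 f -> is_derive t 1 f (derive1 f t).
Proof. by move=> sf; apply/derivable_is_derive; exact: (smooth1_derivable sf 0%N). Qed.

Lemma smooth1_sum (I : Type) (r : seq I) (P : pred I) (F : I -> R -> R) :
  (forall i, smooth1 (F i)) -> smooth1 (fun t => \sum_(i <- r | P i) F i t).
Proof.
move=> sF; elim: r => [|i r IHr].
  by under eq_fun do rewrite big_nil; exact: smooth1_cst.
under eq_fun do rewrite big_cons.
by case: (P i) => //; exact: smooth1_add.
Qed.

Lemma smooth1_prod (I : Type) (r : seq I) (P : pred I) (F : I -> R -> R) :
  (forall i, smooth1 (F i)) -> smooth1 (fun t => \prod_(i <- r | P i) F i t).
Proof.
move=> sF; elim: r => [|i r IHr].
  by under eq_fun do rewrite big_nil; exact: smooth1_cst.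
under eq_fun do rewrite big_cons.
by case: (P i) => //; exact: smooth1_mul.
Qed.

(** * Smooth curves of matrices *)

Definition smooth_mx m n (c : R -> 'M[R]_(m, n)) :=
  forall i j, smooth1 (fun t => c t i j).

Lemma derive1_mx m n (c : R -> 'M[R]_(m, n)) :
  (forall i j t, derivable (fun s => c s i j) t 1) ->
  derive1 c = fun t => \matrix_(i, j) derive1 (fun s => c s i j) t.
Proof.
move=> dc; apply/funext => t; rewrite derive1E derive_mx; last first.
  by apply/derivable_mxP => i j; exact: dc.
by apply/matrixP => i j; rewrite !mxE derive1E.
Qed.

Lemma derive1n_mx m n (c : R -> 'M[R]_(m, n)) l : smooth_mx c ->
  derive1n l c = fun t => \matrix_(i, j) derive1n l (fun s => c s i j) t.
Proof.
move=> sc; elim: l => [|l IHl].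
  by apply/funext => t; apply/matrixP => i j; rewrite mxE.
rewrite derive1nS IHl derive1_mx.
  apply/funext => t; apply/matrixP => i j; rewrite !mxE.
  by congr (derive1 _ t); apply/funext => s; rewrite mxE.
by move=> i j t; under eq_fun do rewrite mxE; exact: (smooth1_derivable (sc i j)).
Qed.

Lemma smoothP n (c : R -> 'rV[R]_n) : smooth c <-> smooth_mx c.
Proof.
split=> [sc|sc l t]; last first.
  rewrite derive1n_mx //; apply/derivable_mxP => i j.
  by under eq_fun do rewrite mxE; exact: (smooth1_derivable (sc i j)).
(* [derive1n_mx] presupposes smooth entries, which is the goal here; the same formula is rebuilt
   from the smoothness of the whole curve. *)
have E l : derive1n l c =
    fun t => \matrix_(i, j) derive1n l (fun s => c s i j) t.
  elim: l => [|l IHl].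
    by apply/funext => t; apply/matrixP => i j; rewrite mxE.
  have dc i j t : derivable (fun s => derive1n l c s i j) t 1.
    by move: (i) (j); apply/derivable_mxP; exact: sc.
  rewrite derive1nS derive1_mx //; apply/funext => t.
  apply/matrixP => i j; rewrite !mxE.
  by congr (derive1 _ t); apply/funext => s; rewrite IHl mxE.
move=> i j; constructor=> l t; have /derivable_mxP/(_ i j) := sc l t.
by rewrite E; under eq_fun do rewrite mxE.
Qed.

Lemma derive1_mxE m n (c : R -> 'M[R]_(m, n)) t i j : smooth_mx c ->
  derive1 c t i j = derive1 (fun s => c s i j) t.
Proof. by move=> sc; rewrite derive1_mx ?mxE // => ? ? s; exact: (smooth1_derivable (sc _ _) 0%N). Qed.

Lemma smooth_mx_tr m n (c : R -> 'M[R]_(m, n)) :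
  smooth_mx c -> smooth_mx (fun t => (c t)^T).
Proof. by move=> sc i j; under eq_fun do rewrite mxE; exact: sc. Qed.

Lemma smooth_mx_mul m n q (c : R -> 'M[R]_(m, n)) (d : R -> 'M[R]_(n, q)) :
  smooth_mx c -> smooth_mx d -> smooth_mx (fun t => c t *m d t).
Proof.
move=> sc sd i j; under eq_fun do rewrite mxE.
by apply: smooth1_sum => k; exact: smooth1_mul.
Qed.

Lemma smooth1_det n (c : R -> 'M[R]_n) :
  smooth_mx c -> smooth1 (fun t => \det (c t)).
Proof.
move=> sc; apply: smooth1_sum => s; apply: smooth1_mul; first exact: smooth1_cst.
exact: smooth1_prod.
Qed.

Lemma smooth_mx_inv n (c : R -> 'M[R]_n) : (forall t, c t \in unitmx) ->
  smooth_mx c -> smooth_mx (fun t => invmx (c t)).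
Proof.
move=> uc sc i j; rewrite /invmx; under eq_fun do rewrite uc !mxE.
apply: smooth1_mul.
  apply: (@smooth1_inv (fun t => \det (c t))); last exact: smooth1_det.
  by move=> t; rewrite -unitfE -unitmxE.
apply: smooth1_mul; first exact: smooth1_cst.
by apply: smooth1_det => i' j'; under eq_fun do rewrite !mxE; exact: sc.
Qed.

(** If x E E^T = 0, then the squared norm x E E^T x^T of x E is 0, hence x E = 0. *)
Lemma gram_unit m n (E : 'M[R]_(m, n)) :
  (forall x : 'rV_m, x *m E = 0 -> x = 0) -> E *m E^T \in unitmx.
Proof.
move=> injE; rewrite -row_free_unit -kermx_eq0; apply/eqP/row_matrixP => i.
rewrite row0; set x := row i _; apply: injE; apply/rowP => j; rewrite [RHS]mxE.
have xE0 : x *m (E *m E^T) = 0 by rewrite -row_mul mulmx_ker row0.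
have /eqP : \sum_j (x *m E) 0 j ^+ 2 = 0.
  have -> : \sum_j (x *m E) 0 j ^+ 2 = ((x *m E) *m (x *m E)^T) 0 0.
    rewrite [RHS]mxE; apply: eq_bigr => l _.
    by rewrite [X in _ = _ * X]mxE expr2.
  by rewrite trmx_mul mulmxA -(mulmxA x) xE0 mul0mx mxE.
rewrite psumr_eq0 => [/allP/(_ j)|l _]; last exact: sqr_ge0.
by rewrite mem_index_enum sqrf_eq0 => /(_ isT)/eqP.
Qed.

(* [x] is recovered smoothly from [x E] through the Gram matrix [E E^T]. *)
Lemma smooth_mx_coef m n (E : R -> 'M[R]_(m, n)) (x : R -> 'rV[R]_m) :
  smooth_mx E -> (forall t (z : 'rV_m), z *m E t = 0 -> z = 0) ->
  smooth_mx (fun t => x t *m E t) -> smooth_mx x.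
Proof.
move=> sE injE sxE.
have -> : x = fun t => (x t *m E t) *m ((E t)^T *m invmx (E t *m (E t)^T)).
  by apply/funext => t; rewrite -mulmxA [E t *m _]mulmxA mulmxV ?mulmx1 ?gram_unit //; exact: injE.
apply: smooth_mx_mul => //; apply: smooth_mx_mul; first exact: smooth_mx_tr.
apply: smooth_mx_inv => [t|]; first by apply: gram_unit; exact: injE.
by apply: smooth_mx_mul => //; exact: smooth_mx_tr.
Qed.

(* A change of parameter with values in a small interval around [0] makes up for
   curves being defined on all of [R]. *)
Definition reparam (phi : R -> R) :=
  [/\ smooth1 phi, phi 0 = 0 & is_derive (0 : R) 1 phi 1].

Lemma reparam_id : reparam id.
Proof. by split; [exact: smooth1_id| |exact: is_derive_id]. Qed.

Lemma reparam_comp phi psi : reparam phi -> reparam psi -> reparam (phi \o psi).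
Proof.
move=> [sf f0 df] [sg g0 dg]; split; first exact: smooth1_comp.
  by rewrite /= g0.
by rewrite -[X in is_derive _ _ _ X]mulr1; apply: is_derive1_comp; rewrite ?g0.
Qed.

(** By continuity g is nonzero on some interval (-e, e), and t / (1 + t^2 / e^2) maps the whole line
    into it with derivative 1 at 0. The bound |t| < e + t^2 / e is clear if |t| < e, and otherwise
    |t| <= t^2 / e. *)
Lemma reparam_neq0 g : smooth1 g -> g 0 != 0 ->
  exists2 phi, reparam phi & forall t, g (phi t) != 0.
Proof.
move=> sg g0.
have cg : {for 0, continuous g}.
  by apply/differentiable_continuous/derivable1_diffP; exact: (smooth1_derivable sg 0%N).
have [e /= e0 ge] : exists2 e : R, 0 < e & forall t, `|t| < e -> g t != 0.
  have : \forall t \near (0 : R), g t != 0 by exact: cvgr_neq0 (g 0) cg g0.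
  case=> e /= e0 He; exists e => // t te; apply: He.
  by rewrite /ball /= sub0r normrN.
pose d t : R := 1 + t * t * (e^-1 * e^-1).
have ei0 : 0 < e^-1 by rewrite invr_gt0.
have d1 t : 1 <= d t.
  by rewrite lerDl mulr_ge0 // -expr2 sqr_ge0.
have d0 t : d t != 0 by rewrite gt_eqF // (lt_le_trans ltr01).
have sd : smooth1 d.
  apply: smooth1_add; first exact: smooth1_cst.
  by apply: smooth1_mul; [apply: smooth1_mul; exact: smooth1_id|exact: smooth1_cst].
have sphi : smooth1 (fun t => t * (d t)^-1).
  by apply: smooth1_mul; [exact: smooth1_id|exact: smooth1_inv].
exists (fun t => t * (d t)^-1).
  split=> //; first by rewrite mul0r.
  have := is_derive_mul (is_derive_id (0 : R) 1)
    (is_derive_inv (d0 0) (smooth1_is_derive 0 sd)).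
  by rewrite /= mul0r addr0 mul1r {2}/d !mul0r addr0 invr1.
move=> t; apply: ge; rewrite normrM normfV (ger0_norm (le_trans ler01 (d1 t))).
rewrite ltr_pdivrMr ?(lt_le_trans ltr01) //.
have -> : e * d t = e + t * t * e^-1 by rewrite /d; field; rewrite gt_eqF.
have [te|te] := ltP `|t| e; first by rewrite ltr_wpDr // mulr_ge0 ?(ltW ei0) // -expr2 sqr_ge0.
rewrite ltr_pwDl // -expr2 -real_normK ?num_real // expr2 -mulrA ler_peMr //.
by rewrite ler_pdivlMr // mul1r.
Qed.

End SmoothReal.

Arguments smooth1_derivable {R f} _ m t.

(** * Rational functions and projections onto lines *)

Section Rational.
Local Open Scope classical_set_scope.
Local Open Scope ring_scope.
Context {R : realType}.

Lemma eq_derive1 (V : normedModType R) (f g : R -> V) t : f =1 g -> derive1 f t = derive1 g t.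
Proof. by move=> /funext ->. Qed.

Lemma is_derive_fsum (I : Type) (r : seq I) (F : I -> R -> R) (a : I -> R)
    (t : R) : (forall i, is_derive t 1 (F i) (a i)) ->
  is_derive t 1 (fun s => \sum_(i <- r) F i s) (\sum_(i <- r) a i).
Proof.
move=> dF; elim: r => [|i r IHr].
  under eq_fun do rewrite big_nil; rewrite big_nil; exact: is_derive_cst.
under eq_fun do rewrite big_cons; rewrite big_cons; exact: is_derive_add.
Qed.

Lemma derive1_mulmx m n q (c : R -> 'M[R]_(m, n)) (d : R -> 'M[R]_(n, q)) t :
  smooth_mx c -> smooth_mx d ->
  derive1 (fun s => c s *m d s) t = derive1 c t *m d t + c t *m derive1 d t.
Proof.
move=> sc sd; apply/matrixP => i j; rewrite derive1_mxE; last exact: smooth_mx_mul.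
under eq_fun do rewrite mxE; rewrite !mxE -big_split /=; apply: is_derive1E.
apply: is_derive_fsum => l; rewrite !derive1_mxE //.
by apply: is_derive_mul; exact: smooth1_is_derive.
Qed.

Lemma line_projE n (w : 'rV[R]_n) i j :
  line_proj w i j = ((w *m w^T) 0 0)^-1 * (w 0 i * w 0 j).
Proof. by rewrite !mxE big_ord1 !mxE. Qed.

Lemma sqnormE n (w : 'rV[R]_n) : (w *m w^T) 0 0 = \sum_i w 0 i ^+ 2.
Proof. by rewrite mxE; apply: eq_bigr => i _; rewrite mxE expr2. Qed.

Lemma sqnorm_neq0 n (w : 'rV[R]_n) : w != 0 -> (w *m w^T) 0 0 != 0.
Proof.
apply: contra => /eqP w0; apply/eqP/rowP => j; rewrite [RHS]mxE.
move: w0; rewrite sqnormE => /eqP; rewrite psumr_eq0 => [/allP/(_ j)|l _].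
  by rewrite mem_index_enum sqrf_eq0 => /(_ isT)/eqP.
exact: sqr_ge0.
Qed.

Lemma mul_line_proj n (v w : 'rV[R]_n) :
  v *m line_proj w = (((w *m w^T) 0 0)^-1 * (v *m w^T) 0 0) *: w.
Proof.
by rewrite /line_proj -scalemxAr mulmxA {1}[v *m _]mx11_scalar mul_scalar_mx scalerA.
Qed.

Lemma line_projK n (w : 'rV[R]_n) : w != 0 -> w *m line_proj w = w.
Proof. by move=> w0; rewrite mul_line_proj mulVf ?scale1r // sqnorm_neq0. Qed.

Lemma line_projZ n (a : R) (w : 'rV[R]_n) : a != 0 ->
  line_proj (a *: w) = line_proj w.
Proof.
move=> a0; apply/matrixP => i j; rewrite !line_projE !sqnormE.
under eq_bigr do rewrite mxE exprMn; rewrite -mulr_sumr !mxE.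
have [->|s0] := eqVneq (\sum_l w 0 l ^+ 2) 0; first by rewrite mulr0 !invr0 !mul0r.
by field; rewrite s0 a0.
Qed.

Lemma line_proj_inj n (v w : 'rV[R]_n) : v != 0 -> line_proj v = line_proj w ->
  exists a, v = a *: w.
Proof.
by move=> v0 vw; exists (((w *m w^T) 0 0)^-1 * (v *m w^T) 0 0);
  rewrite -mul_line_proj -vw line_projK.
Qed.

Lemma base_pair_line n (p w : 'rV[R]_n) : base_pt (pair_line p w) = p.
Proof. exact: row_mxKl. Qed.

Lemma line_of_pair n (p w v : 'rV[R]_n) : w != 0 ->
  line_of (pair_line p w) v <-> exists a, v = a *: w.
Proof.
move=> w0; rewrite /line_of /= row_mxKr mxvecK; split.
  by move=> /submxP[x ->]; eexists; rewrite mul_line_proj.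
by case=> a ->; rewrite -{1}(line_projK w0) scalemx_sub // submxMl.
Qed.

Lemma smooth_mx_line_proj n (w : R -> 'rV[R]_n) : (forall t, w t != 0) ->
  smooth_mx w -> smooth_mx (fun t => line_proj (w t)).
Proof.
move=> w0 sw i j; under eq_fun do rewrite line_projE sqnormE.
apply: smooth1_mul; last exact: smooth1_mul.
apply: (@smooth1_inv _ (fun t => \sum_i w t 0 i ^+ 2)).
  by move=> t; rewrite -sqnormE sqnorm_neq0.
by apply: smooth1_sum => l; under eq_fun do rewrite expr2; exact: smooth1_mul.
Qed.

(* Differentiate [w P = w] for the projection [P] onto the line of [w]. *)
Lemma derive1_line_proj0 n (w : R -> 'rV[R]_n) t : (forall t, w t != 0) ->
  smooth_mx w -> derive1 (fun s => line_proj (w s)) t = 0 ->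
  exists a, derive1 w t = a *: w t.
Proof.
move=> w0 sw dP.
have := derive1_mulmx t sw (smooth_mx_line_proj w0 sw).
under eq_fun do rewrite line_projK //.
by rewrite dP mulmx0 addr0 mul_line_proj => ->; eexists.
Qed.

(* No denominator vanishes anywhere on [I -> R]: the only ones that occur in charts
   are the [w *m w^T] of [line_proj w]. *)
Inductive ratfun (I : Type) : ((I -> R) -> R) -> Prop :=
| ratfun_cst a : ratfun (fun=> a)
| ratfun_var i : ratfun (fun y => y i)
| ratfun_add f g : ratfun f -> ratfun g -> ratfun (fun y => f y + g y)
| ratfun_mul f g : ratfun f -> ratfun g -> ratfun (fun y => f y * g y)
| ratfun_inv f : (forall y, f y != 0) -> ratfun f -> ratfun (fun y => (f y)^-1).

Lemma ratfun_comp (I J : Type) (f : (I -> R) -> R) (g : (J -> R) -> I -> R) :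
  ratfun f -> (forall i, ratfun (fun y => g y i)) -> ratfun (fun y => f (g y)).
Proof.
move=> rf rg; elim: rf => {f} [a|i|f h _ rf _ rh|f h _ rf _ rh|f f0 _ rf] //.
- exact: ratfun_cst.
- exact: ratfun_add.
- exact: ratfun_mul.
- exact: ratfun_inv.
Qed.

Lemma ratfun_sum (I K : Type) (r : seq K) (F : K -> (I -> R) -> R) :
  (forall k, ratfun (F k)) -> ratfun (fun y => \sum_(k <- r) F k y).
Proof.
move=> rF; elim: r => [|k r IHr].
  by under eq_fun do rewrite big_nil; exact: ratfun_cst.
by under eq_fun do rewrite big_cons; exact: ratfun_add.
Qed.

Lemma ratfun_smooth1 (I : Type) (f : (I -> R) -> R) (y : R -> I -> R) :
  ratfun f -> (forall i, smooth1 (fun t => y t i)) -> smooth1 (fun t => f (y t)).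
Proof.
move=> rf sy; elim: rf => {f} [a|i|f h _ rf _ rh|f h _ rf _ rh|f f0 _ rf] //.
- exact: smooth1_cst.
- exact: smooth1_add.
- exact: smooth1_mul.
- exact: smooth1_inv.
Qed.

(** The differential is rational jointly in the point and the direction; the index type [I + I]
    holds the two families of variables. Rationality thus survives the derivative taken in each
    prolongation. *)
Lemma ratfun_diff (I : Type) (f : (I -> R) -> R) : ratfun f ->
  exists Df : (I -> R) -> (I -> R) -> R,
  [/\ ratfun (fun z : I + I -> R => Df (z \o inl) (z \o inr)),
      forall (y : R -> I -> R) (e : I -> R) (t : R),
        (forall i, is_derive t 1 (fun s => y s i) (e i)) ->
        is_derive t 1 (fun s => f (y s)) (Df (y t) e)
    & forall y e d a b,
        Df y (fun i => a * e i + b * d i) = a * Df y e + b * Df y d].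
Proof.
elim=> {f} [a|i|f g rf [Df [rDf cf lf]] rg [Dg [rDg cg lg]]
                |f g rf [Df [rDf cf lf]] rg [Dg [rDg cg lg]]|f f0 rf [Df [rDf cf lf]]].
- exists (fun _ _ => 0); split=> [|y e t _|y e d b c].
  + exact: ratfun_cst.
  + exact: is_derive_cst.
  + by rewrite !mulr0 addr0.
- exists (fun _ e => e i); split=> //; exact: ratfun_var.
- exists (fun y e => Df y e + Dg y e); split=> [|y e t dy|y e d a b].
  + exact: ratfun_add.
  + exact: is_derive_add (cf _ _ _ dy) (cg _ _ _ dy).
  + by rewrite lf lg; ring.
- have rl h : ratfun h -> ratfun (fun z : I + I -> R => h (z \o inl)).
    by move=> rh; apply: (ratfun_comp rh) => i; exact: ratfun_var.
  exists (fun y e => Df y e * g y + f y * Dg y e); split=> [|y e t dy|y e d a b].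
  + by apply: ratfun_add; apply: ratfun_mul => //; exact: rl.
  + exact: is_derive_mul (cf _ _ _ dy) (cg _ _ _ dy).
  + by rewrite lf lg; ring.
- exists (fun y e => -1 * Df y e * ((f y)^-1 * (f y)^-1)).
  split=> [|y e t dy|y e d a b].
  + have rfi : ratfun (fun z : I + I -> R => (f (z \o inl))^-1).
      apply: (@ratfun_inv _ (fun z => f (z \o inl))) => //.
      by apply: (ratfun_comp rf) => i; exact: ratfun_var.
    by do ![apply: ratfun_mul => //]; exact: ratfun_cst.
  + by rewrite mulN1r; exact: is_derive_inv (f0 _) (cf _ _ _ dy).
  + by rewrite lf; ring.
Qed.

(** * Rational maps and their directional derivatives *)

Definition ratmap n (F : (nat -> R) -> 'rV[R]_n) :=
  forall j, ratfun (fun y => F y 0 j).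

Definition ratfield (e : (nat -> R) -> nat -> R) :=
  forall i, ratfun (fun y => e y i).

Definition smooth_env (y : R -> nat -> R) := forall i, smooth1 (fun t => y t i).

Definition ddir n (F : (nat -> R) -> 'rV[R]_n) (y e : nat -> R) : 'rV[R]_n :=
  derive1 (fun s => F (fun i => y i + s * e i)) 0.

Lemma eq_ddir n (F G : (nat -> R) -> 'rV[R]_n) y z e d :
  (forall s, F (fun i => y i + s * e i) = G (fun i => z i + s * d i)) ->
  ddir F y e = ddir G z d.
Proof. by move=> /funext FG; rewrite /ddir FG. Qed.

Lemma ratmap_smooth n (F : (nat -> R) -> 'rV[R]_n) y :
  ratmap F -> smooth_env y -> smooth_mx (fun t => F (y t)).
Proof. by move=> rF sy i j; rewrite ord1; exact: (ratfun_smooth1 (rF j)). Qed.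

Lemma smooth_line (y e : nat -> R) : smooth_env (fun t i => y i + t * e i).
Proof.
move=> i; apply: smooth1_add; first exact: smooth1_cst.
by apply: smooth1_mul; [exact: smooth1_id|exact: smooth1_cst].
Qed.

Lemma derive1_line (a b t : R) : derive1 (fun s : R => a + s * b) t = b.
Proof.
apply: is_derive1E.
have := is_derive_add (is_derive_cst a t 1)
  (is_derive_mul (is_derive_id t 1) (is_derive_cst b t 1)).
by rewrite mul1r mulr0 addr0 add0r.
Qed.

Lemma ddirE n (F : (nat -> R) -> 'rV[R]_n) : ratmap F ->
  exists Df : 'I_n -> (nat -> R) -> (nat -> R) -> R,
  [/\ forall j, ratfun (fun z : nat + nat -> R => Df j (z \o inl) (z \o inr)),
      forall j (y : R -> nat -> R) (t : R), smooth_env y ->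
        derive1 (fun s => F (y s) 0 j) t =
        Df j (y t) (fun i => derive1 (fun s => y s i) t),
      forall j y e d a b,
        Df j y (fun i => a * e i + b * d i) = a * Df j y e + b * Df j y d
    & forall y e j, ddir F y e 0 j = Df j y e].
Proof.
move=> rF; have /choice[Df HDf] j := ratfun_diff (rF j).
have chain j (y : R -> nat -> R) (t : R) : smooth_env y ->
  derive1 (fun s => F (y s) 0 j) t = Df j (y t) (fun i => derive1 (fun s => y s i) t).
  move=> sy; have [_ c _] := HDf j; apply: is_derive1E; apply: c => i.
  exact: smooth1_is_derive.
exists Df; split=> // [j|j|y e j]; do ?by have [] := HDf j.
have sl : smooth_env (fun s i => y i + s * e i) by exact: smooth_line.
rewrite /ddir derive1_mxE; last exact (ratmap_smooth rF sl).
rewrite (chain j _ 0 sl).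
by congr (Df j _ _); apply/funext => i; rewrite ?derive1_line ?mul0r ?addr0.
Qed.

Lemma ddir_chain n (F : (nat -> R) -> 'rV[R]_n) y t : ratmap F ->
  smooth_env y ->
  derive1 (fun s => F (y s)) t = ddir F (y t) (fun i => derive1 (fun s => y s i) t).
Proof.
move=> rF sy; have [Df [_ chain _ E]] := ddirE rF; apply/rowP => j.
by rewrite derive1_mxE ?chain ?E //; exact: ratmap_smooth.
Qed.

Lemma ddir_lin n (F : (nat -> R) -> 'rV[R]_n) y a b e d : ratmap F ->
  ddir F y (fun i => a * e i + b * d i) = a *: ddir F y e + b *: ddir F y d.
Proof.
move=> rF; have [Df [_ _ lin E]] := ddirE rF; apply/rowP => j.
by rewrite !mxE !E lin.
Qed.

Lemma ratmap_ddir n (F : (nat -> R) -> 'rV[R]_n) g e :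
  ratmap F -> ratfield g -> ratfield e -> ratmap (fun y => ddir F (g y) (e y)).
Proof.
move=> rF rg re j; have [Df [rDf _ _ E]] := ddirE rF.
under eq_fun do rewrite E.
pose z y (i : nat + nat) := match i with inl i => g y i | inr i => e y i end.
have -> : (fun y => Df j (g y) (e y)) = (fun y => Df j (z y \o inl) (z y \o inr)).
  by apply/funext => y; congr (Df j _ _); apply/funext.
by apply: (ratfun_comp (rDf j)) => -[i|i]; [exact: rg|exact: re].
Qed.

Lemma ratmap_pair_line n (F G : (nat -> R) -> 'rV[R]_n) :
  ratmap F -> ratmap G -> (forall y, G y != 0) ->
  ratmap (fun y => pair_line (F y) (G y)).
Proof.
move=> rF rG G0 j; case: (split_ordP j) => i ->.
  by under eq_fun do rewrite row_mxEl; exact: rF.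
under eq_fun do rewrite row_mxEr; case/mxvec_indexP: i => a b.
under eq_fun do rewrite mxvecE line_projE sqnormE.
apply: ratfun_mul; last by apply: ratfun_mul; exact: rG.
apply: (@ratfun_inv _ (fun y => \sum_l G y 0 l ^+ 2)) => [y|].
  by rewrite -sqnormE sqnorm_neq0.
apply: ratfun_sum => l; under eq_fun do rewrite expr2.
by apply: ratfun_mul; exact: rG.
Qed.

End Rational.

(** * Kumpera-Rubin charts *)

Section Chart.
Local Open Scope classical_set_scope.
Local Open Scope ring_scope.
Context {R : realType}.
Local Notation env := (nat -> R).

Definition nonzero_on_line k (p : mpoint R k.+1) (g : mpoint R k -> R) : bool :=
  `[< exists2 w, line_of p w &
      differential_on (carrier (monster R k)) g (base_pt p) w != 0 >].

(* The position in [(f_k, u_k, v_k)] of the function which becomes [f_{k+1}]. *)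
Definition pivot k (p : mpoint R k.+1) : nat :=
  let: (f, u, _) := KR (base_pt p) in
  if nonzero_on_line p f then 0 else if nonzero_on_line p u then 1 else 2.

(* In the frame dual to [(df_k, du_k, dv_k)], the vector of the line [l_k] on which
   [df_{k+1}] is [x] has the coordinates [coef_f s x u v], [coef_u s x u v] and
   [coef_v s x u v], where [s] is the pivot and [u], [v] are the values of [dg],
   [dh] on this vector; they are [u_{k+1}], [v_{k+1}] when [x = 1]. *)
Definition coef_f (s : nat) (x u v : R) : R := if s is 0 then x else u.
Definition coef_u (s : nat) (x u v : R) : R :=
  match s with 0 => u | 1 => x | _ => v end.
Definition coef_v (s : nat) (x u v : R) : R :=
  match s with 0 | 1 => v | _ => x end.

(* Coordinates on [P^k] are given as [y : nat -> R] with [y 0 = x] and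
   [u_i = y (2 i + 1)], [v_i = y (2 i + 2)] for [i <= k]; the other entries of [y]
   are irrelevant.  The function [f_k] is the entry number [fidx p], and
   [wfield p] is the vector field of [Delta_k] dual to [df_k].  The point [p]
   matters only through the pivots below it. *)
Definition dir (k : nat) (W : env) (a b c : R) : env :=
  fun i => a * W i + b * (i == k.*2.+1)%:R + c * (i == k.*2.+2)%:R.

Fixpoint wfield (k : nat) : mpoint R k -> env -> env :=
  match k return mpoint R k -> env -> env with
  | 0 => fun _ _ i => (i == 0)%:R
  | k'.+1 => fun p y =>
      let u := y k'.*2.+3 in let v := y k'.*2.+4 in let s := pivot p in
      dir k' (wfield (base_pt p) y) (coef_f s 1 u v) (coef_u s 1 u v)
        (coef_v s 1 u v)
  end.

Fixpoint fidx (k : nat) : mpoint R k -> nat :=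
  match k return mpoint R k -> nat with
  | 0 => fun _ => 0%N
  | k'.+1 => fun p =>
      match pivot p with
      | 0 => fidx (base_pt p) | 1 => k'.*2.+1 | _ => k'.*2.+2
      end
  end.

Fixpoint chart (k : nat) : mpoint R k -> env -> mpoint R k :=
  match k return mpoint R k -> env -> mpoint R k with
  | 0 => fun _ y => \row_(i < 3) y i
  | k'.+1 => fun p y =>
      pair_line (chart (base_pt p) y) (ddir (chart (base_pt p)) y (wfield p y))
  end.

Definition dchart k (p : mpoint R k) (y e : env) : mpoint R k :=
  ddir (chart p) y e.

Definition tdir k (p : mpoint R k) (y : env) (a b c : R) : env :=
  dir k (wfield p y) a b c.

Lemma wfieldS k (p : mpoint R k.+1) y :
  wfield p y = tdir (base_pt p) y (coef_f (pivot p) 1 (y k.*2.+3) (y k.*2.+4))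
    (coef_u (pivot p) 1 (y k.*2.+3) (y k.*2.+4))
    (coef_v (pivot p) 1 (y k.*2.+3) (y k.*2.+4)).
Proof. by []. Qed.

Lemma chartS k (p : mpoint R k.+1) y : chart p y =
  pair_line (chart (base_pt p) y) (dchart (base_pt p) y (wfield p y)).
Proof. by []. Qed.

Lemma wfield_ge k (p : mpoint R k) y i : (k.*2 < i)%N -> wfield p y i = 0.
Proof.
elim: k p => [|k IHk] p; first by case: i.
move=> ki; rewrite wfieldS /tdir /dir IHk ?mulr0 ?add0r; last by lia.
by rewrite !gtn_eqF ?mulr0 ?addr0 //; lia.
Qed.

Lemma fidx_le k (p : mpoint R k) : (fidx p <= k.*2)%N.
Proof.
elim: k p => [|k IHk] p //=; have := IHk (base_pt p).
by case: (pivot p) => [|[|_]]; lia.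
Qed.

Lemma tdir_u k (p : mpoint R k) y a b c : tdir p y a b c k.*2.+1 = b.
Proof.
by rewrite /tdir /dir wfield_ge // eqxx ltn_eqF // mulr0 add0r mulr1 mulr0 addr0.
Qed.

Lemma tdir_v k (p : mpoint R k) y a b c : tdir p y a b c k.*2.+2 = c.
Proof.
by rewrite /tdir /dir wfield_ge // eqxx gtn_eqF // !mulr0 !add0r mulr1.
Qed.

Lemma tdir_lt k (p : mpoint R k) y a b c i : (i <= k.*2)%N ->
  tdir p y a b c i = a * wfield p y i.
Proof. by move=> ik; rewrite /tdir /dir !ltn_eqF ?mulr0 ?addr0 //; lia. Qed.

Lemma wfield_f k (p : mpoint R k) y : wfield p y (fidx p) = 1.
Proof.
elim: k p => [|k IHk] p //; rewrite wfieldS /=.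
case: (pivot p) => [|[|s]] /=; rewrite ?tdir_u ?tdir_v //.
by rewrite tdir_lt ?fidx_le // IHk mulr1.
Qed.

Lemma tdir_f k (p : mpoint R k) y a b c : tdir p y a b c (fidx p) = a.
Proof. by rewrite tdir_lt ?fidx_le // wfield_f mulr1. Qed.

(** The coordinates of P^k are the first 2k + 3 entries. Infinite environments give all levels the
    same coordinate type, at the price of uniqueness only up to [agree k]. *)
Definition agree k (y z : env) := forall i, (i < k.*2.+3)%N -> y i = z i.

Lemma agreeW k y z : agree k.+1 y z -> agree k y z.
Proof. by move=> yz i ik; apply: yz; lia. Qed.

Lemma wfield_ext k (p : mpoint R k) y z : agree k y z -> wfield p y = wfield p z.
Proof.
elim: k p => [|k IHk] p // yz; rewrite !wfieldS /tdir (IHk _ (agreeW yz)).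
by rewrite !yz //; lia.
Qed.

Lemma tdir_ext k (p : mpoint R k) y z a b c :
  agree k y z -> tdir p y a b c = tdir p z a b c.
Proof. by move=> yz; rewrite /tdir (wfield_ext p yz). Qed.

Lemma chart_ext k (p : mpoint R k) y z : agree k y z -> chart p y = chart p z.
Proof.
elim: k p y z => [|k IHk] p y z yz.
  by apply/rowP => i; rewrite !mxE yz.
rewrite !chartS (IHk _ y z) ?(wfield_ext p yz); last exact: agreeW.
congr (pair_line _ _); apply: eq_ddir => s; apply: IHk => i ik.
by rewrite (agreeW yz).
Qed.

Lemma dchart_ext k (p : mpoint R k) y z e d :
  agree k y z -> agree k e d -> dchart p y e = dchart p z d.
Proof.
by move=> yz ed; apply: eq_ddir => s; apply: chart_ext => i ik; rewrite yz ?ed.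
Qed.

Lemma ratfield_wfield k (p : mpoint R k) : ratfield (wfield p).
Proof.
elim: k p => [|k IHk] p i; first exact: ratfun_cst.
have rc f (g : env -> R) : ratfun g -> ratfun (fun y => g y * f).
  by move=> rg; apply: ratfun_mul => //; exact: ratfun_cst.
under eq_fun do rewrite wfieldS /tdir /dir.
case: (pivot p) => [|[|s]] /=; do ![apply: ratfun_add|apply: rc|
  apply: ratfun_mul|exact: IHk|exact: ratfun_var|exact: ratfun_cst].
Qed.

Lemma ratfield_id : ratfield (id : env -> env).
Proof. by move=> i; exact: ratfun_var. Qed.

Lemma ddir_line n (F : env -> 'rV[R]_n) y e : ratmap F -> ddir F y e =
  \row_j derive1 (fun s => F (fun i => y i + s * e i) 0 j) 0.
Proof.
move=> rF; apply/rowP => j; rewrite /ddir derive1_mxE ?mxE //.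
exact: (ratmap_smooth rF (@smooth_line _ y e)).
Qed.

Definition dchart_injective k (p : mpoint R k) :=
  forall y e, dchart p y e = 0 -> agree k e (fun=> 0).

Lemma dchart_wfield_neq0 k (p : mpoint R k.+1) y :
  dchart_injective (base_pt p) -> dchart (base_pt p) y (wfield p y) != 0.
Proof.
move=> inj; apply/eqP => /inj /(_ (fidx p)).
rewrite wfield_f => W0; have := fidx_le p => fp.
by have /eqP := W0 ltac:(lia); rewrite oner_eq0.
Qed.

(** With the lower coordinates fixed, [wfield p] is affine in the two new fiber coordinates, and its
    linear part has pivot component 0. *)
Lemma wfield_line k (p : mpoint R k.+1) y e s : agree k e (fun=> 0) ->
  wfield p (fun i => y i + s * e i) =
  fun i => 1 * wfield p y i + s * tdir (base_pt p) y
    (coef_f (pivot p) 0 (e k.*2.+3) (e k.*2.+4))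
    (coef_u (pivot p) 0 (e k.*2.+3) (e k.*2.+4))
    (coef_v (pivot p) 0 (e k.*2.+3) (e k.*2.+4)) i.
Proof.
move=> e0; rewrite !wfieldS.
rewrite (@tdir_ext _ (base_pt p) _ y); last by move=> i ik; rewrite e0 // mulr0 addr0.
apply/funext => i; rewrite /tdir /dir.
by case: (pivot p) => [|[|r]] /=; ring.
Qed.

(** The two properties need each other: the next chart is rational because the vector spanning its
    line never vanishes, and this follows from injectivity of the differential one level lower. *)
Lemma chart_spec k (p : mpoint R k) : ratmap (chart p) /\ dchart_injective p.
Proof.
elim: k p => [|k IHk] p.
  have r0 : ratmap (chart p).
    by move=> j; under eq_fun do rewrite mxE; exact: ratfun_var.
  split=> // y e; rewrite /dchart (ddir_line y e r0) => /rowP e0 i i3.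
  have := e0 (Ordinal i3); rewrite !mxE => H; rewrite -[RHS]H.
  by under eq_fun do rewrite mxE; rewrite derive1_line.
have [rb ib] := IHk (base_pt p).
have lin y a b e d : dchart (base_pt p) y (fun i => a * e i + b * d i) =
  a *: dchart (base_pt p) y e + b *: dchart (base_pt p) y d by exact: ddir_lin.
have rG : ratmap (fun y => dchart (base_pt p) y (wfield p y)).
  by apply: ratmap_ddir => //; [exact: ratfield_id|exact: ratfield_wfield].
have G0 y := dchart_wfield_neq0 y ib.
have rp : ratmap (chart p) by exact: ratmap_pair_line.
split=> // y e; rewrite /dchart (ddir_line y e rp) => /rowP de0.
have e0 : agree k e (fun=> 0).
  apply: (ib y); rewrite /dchart (ddir_line y e rb); apply/rowP => j; rewrite !mxE.
  have := de0 (lshift _ j); rewrite !mxE => H; rewrite -[RHS]H.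
  by apply: eq_derive1 => s; rewrite chartS row_mxEl.
set d := tdir (base_pt p) y
    (coef_f (pivot p) 0 (e k.*2.+3) (e k.*2.+4))
    (coef_u (pivot p) 0 (e k.*2.+3) (e k.*2.+4))
    (coef_v (pivot p) 0 (e k.*2.+3) (e k.*2.+4)).
pose G s := dchart (base_pt p) (fun i => y i + s * e i)
  (wfield p (fun i => y i + s * e i)).
have GE s : G s = dchart (base_pt p) y (wfield p y) + s *: dchart (base_pt p) y d.
  rewrite -(scale1r (dchart (base_pt p) y (wfield p y))).
  rewrite -lin.
  rewrite -(wfield_line p y s e0).
  by apply: dchart_ext => // i ik; rewrite e0 // mulr0 addr0.
have Gn0 s : G s != 0 by exact: G0.
have sG : smooth_mx G by exact: (ratmap_smooth rG (@smooth_line _ y e)).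
(* The line does not move to first order, so the derivative of its spanning vector is a multiple [a]
   of that vector. *)
have [|a] := @derive1_line_proj0 _ _ G 0 Gn0 sG.
  rewrite derive1_mx; last first.
    by have sl := smooth_mx_line_proj Gn0 sG => i j t; exact: (smooth1_derivable (sl i j) 0%N).
  apply/matrixP => i j; rewrite [LHS]mxE [RHS]mxE.
  have := de0 (rshift _ (mxvec_index i j)); rewrite !mxE => H; rewrite -[RHS]H.
  by apply: eq_derive1 => s; rewrite chartS row_mxEr mxvecE.
have -> : derive1 G 0 = dchart (base_pt p) y d.
  apply/rowP => j; rewrite derive1_mxE //.
  by under eq_fun do rewrite GE !mxE; rewrite derive1_line.
rewrite GE scale0r addr0 => dE.
have dW : agree k (fun i => 1 * d i + (- a) * wfield p y i) (fun=> 0).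
  by apply: (ib y); rewrite lin dE scale1r scaleNr subrr.
(* The spanning vector is normalized to have pivot component 1, so its variation [d] has pivot
   component 0; comparison gives a = 0. *)
have d0 : d (fidx p) = 0.
  by rewrite /d /=; case: (pivot p) => [|[|s]] /=; rewrite ?tdir_f ?tdir_u ?tdir_v.
have a0 : a = 0.
  have fp := fidx_le p; have := dW (fidx p) ltac:(lia).
  by rewrite d0 wfield_f mulr0 add0r mulr1 => /eqP; rewrite oppr_eq0 => /eqP.
have D i : (i < k.*2.+3)%N -> d i = 0.
  by move=> /dW; rewrite a0 oppr0 mul0r addr0 mul1r.
have fb := fidx_le (base_pt p).
have := D k.*2.+1 ltac:(lia); have := D k.*2.+2 ltac:(lia).
have := D (fidx (base_pt p)) ltac:(lia); rewrite /d tdir_f tdir_u tdir_v => f0 v0 u0.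
move=> i; have [ik _|ki ik] := ltnP i k.*2.+3; first exact: e0.
have {ik ki} : i = k.*2.+3 \/ i = k.*2.+4 by lia.
by case: (pivot p) f0 v0 u0 => [|[|s]] /= f0 v0 u0 [] ->.
Qed.

Lemma ratmap_chart k (p : mpoint R k) : ratmap (chart p).
Proof. by case: (chart_spec p). Qed.

Lemma dchart_inj0 k (p : mpoint R k) : dchart_injective p.
Proof. by case: (chart_spec p). Qed.

Lemma dchart_lin k (p : mpoint R k) y a b e d :
  dchart p y (fun i => a * e i + b * d i) = a *: dchart p y e + b *: dchart p y d.
Proof. exact/ddir_lin/ratmap_chart. Qed.

Lemma dchart_inj k (p : mpoint R k) y e d :
  dchart p y e = dchart p y d -> agree k e d.
Proof.
move=> ed i ik; apply/eqP; rewrite -subr_eq0; apply/eqP.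
have := @dchart_inj0 k p y (fun i => 1 * e i + (-1) * d i) _ i ik.
rewrite mul1r mulN1r; apply.
by rewrite dchart_lin ed scale1r scaleN1r subrr.
Qed.

Lemma dchartZ k (p : mpoint R k) y a e :
  dchart p y (fun i => a * e i) = a *: dchart p y e.
Proof.
rewrite -[RHS]addr0 -[X in _ + X](scale0r (dchart p y e)) -dchart_lin.
by congr (dchart p y _); apply/funext => i; rewrite mul0r addr0.
Qed.

Lemma chart_inj k (p : mpoint R k) y z : chart p y = chart p z -> agree k y z.
Proof.
elim: k p => [|k IHk] p; first by move=> /rowP yz i ik; have := yz (Ordinal ik); rewrite !mxE.
rewrite !chartS => /eq_row_mx[/IHk yz /(can_inj mxvecK)].
move=> /line_proj_inj[|a]; first exact/dchart_wfield_neq0/dchart_inj0.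
rewrite -(@dchart_ext _ _ y z (wfield p z) (wfield p z)) // -dchartZ.
move=> /dchart_inj Wyz.
have fp := fidx_le p; have fb := fidx_le (base_pt p).
have := Wyz (fidx p) ltac:(lia); rewrite !wfield_f mulr1 => a1.
have := Wyz (fidx (base_pt p)) ltac:(lia); have := Wyz k.*2.+1 ltac:(lia).
have := Wyz k.*2.+2 ltac:(lia).
rewrite -a1 !mul1r !wfieldS !tdir_f !tdir_u !tdir_v => v0 u0 f0.
move=> i; have [ik _|ki ik] := ltnP i k.*2.+3; first exact: yz.
have {ik ki} : i = k.*2.+3 \/ i = k.*2.+4 by lia.
by case: (pivot p) f0 v0 u0 => [|[|s]] /= f0 v0 u0 [] ->.
Qed.

End Chart.

(** * Lifting curves and the distribution in a chart *)

Section Lift.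
Local Open Scope classical_set_scope.
Local Open Scope ring_scope.
Context {R : realType}.
Local Notation env := (nat -> R).
Local Notation Z k := (carrier (monster R k)).
Local Notation Delta k := (distr (monster R k)).

Lemma derive1_reparam n (c : R -> 'rV[R]_n) phi :
  smooth_mx c -> reparam phi -> derive1 (c \o phi) 0 = derive1 c 0.
Proof.
move=> sc [sphi phi0 dphi]; apply/rowP => j.
have scp : smooth_mx (c \o phi) by move=> i l; exact: smooth1_comp (sc i l) sphi.
rewrite !derive1_mxE //; apply: is_derive1E.
rewrite -[X in is_derive _ _ _ X]mulr1; apply: (@is_derive1_comp _ (fun t => c t 0 j) phi) => //.
by rewrite phi0; exact: smooth1_is_derive.
Qed.

Lemma smooth_base n (c : R -> 'rV[R]_(n + n * n)) :
  smooth_mx c -> smooth_mx (fun t => base_pt (c t)).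
Proof. by move=> sc i j; under eq_fun do rewrite mxE; exact: sc. Qed.

Lemma base_derive1 n (c : R -> 'rV[R]_(n + n * n)) t : smooth_mx c ->
  base_pt (derive1 c t) = derive1 (fun s => base_pt (c s)) t.
Proof.
move=> sc; apply/rowP => j; rewrite mxE !derive1_mxE //; last exact: smooth_base.
by apply: eq_derive1 => s; rewrite mxE.
Qed.

Lemma smooth_chart k (p : mpoint R k) y : smooth_env y ->
  smooth_mx (fun t => chart p (y t)).
Proof. exact/ratmap_smooth/ratmap_chart. Qed.

Lemma base_chart k (p : mpoint R k.+1) y :
  base_pt (chart p y) = chart (base_pt p) y.
Proof. exact: base_pair_line. Qed.

Lemma base_dchart k (p : mpoint R k.+1) y e :
  base_pt (dchart p y e) = dchart (base_pt p) y e.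
Proof.
rewrite /dchart /ddir base_derive1; last first.
  exact: (@smooth_chart k.+1 p _ (smooth_line y e)).
by under eq_fun do rewrite base_chart.
Qed.

Lemma dchart0 (p : mpoint R 0) y e : dchart p y e = \row_(i < 3) e i.
Proof.
apply/rowP => j; rewrite /dchart ddir_line ?mxE; last exact: ratmap_chart.
by under eq_fun do rewrite mxE; rewrite derive1_line.
Qed.

(** These undo [coef_f], [coef_u], [coef_v]: from the components on (df_k, du_k, dv_k) they return
    the values of df_{k+1}, dg and dh. [coef_pivot] also serves to select any one of the three
    components. *)
Definition coef_pivot (s : nat) (a b c : R) : R :=
  match s with 0 => a | 1 => b | _ => c end.
Definition coef_fst (s : nat) (a b c : R) : R := if s is 0 then b else a.
Definition coef_snd (s : nat) (a b c : R) : R :=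
  match s with 0 | 1 => c | _ => b end.

Definition extend k (y : env) (u v : R) : env :=
  fun i => if i == k.*2.+3 then u else if i == k.*2.+4 then v else y i.

Lemma agree_extend k y u v : agree k (extend k y u v) y.
Proof. by move=> i ik; rewrite /extend !ltn_eqF //; lia. Qed.

Lemma line_of_chart k (p : mpoint R k.+1) y v :
  line_of (chart p y) v <-> exists a, v = dchart (base_pt p) y (fun i => a * wfield p y i).
Proof.
rewrite chartS line_of_pair; last exact/dchart_wfield_neq0/dchart_inj0.
by split=> -[a ->]; exists a; rewrite dchartZ.
Qed.

Lemma eq_pair_line n (p q v w : 'rV[R]_n) :
  p = q -> line_proj v = line_proj w -> pair_line p v = pair_line q w.
Proof. by move=> -> vw; rewrite /pair_line vw. Qed.

(** Dividing a spanning vector by its pivot component [N] keeps its line and makes it the normalized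
    vector of the chart. *)
Lemma chart_extend k (p : mpoint R k.+1) y a b c :
  let s := pivot p in let N := coef_pivot s a b c in N != 0 ->
  chart p (extend k y (coef_fst s a b c / N) (coef_snd s a b c / N)) =
  pair_line (chart (base_pt p) y)
    (dchart (base_pt p) y (tdir (base_pt p) y a b c)).
Proof.
move=> s N N0; set z := extend _ _ _ _; have zy : agree k z y by exact: agree_extend.
rewrite chartS; apply: eq_pair_line; first exact: chart_ext zy.
rewrite -(line_projZ _ N0) -dchartZ; congr (line_proj _); apply: dchart_ext => // i _.
rewrite wfieldS (tdir_ext _ _ _ _ zy) /z /extend eqxx gtn_eqF // eqxx -/s.
rewrite /tdir /dir; move: N0; rewrite /N {z zy N}.
by case: s => [|[|s]] /= N0; field.
Qed.

Lemma vec_smooth n (c : R -> 'rV[R]_(n + n * n)) : smooth_mx c ->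
  smooth_mx (fun t => vec_mx (rsubmx (c t)) : 'M[R]_n).
Proof. by move=> sc i j; under eq_fun do rewrite !mxE; exact: sc. Qed.

Definition liftable k : Prop := forall (p : mpoint R k) (c : R -> mpoint R k) y,
  curve_in (Z k) c -> c 0 = chart p y ->
  exists phi z, [/\ reparam phi, smooth_env z & forall t, c (phi t) = chart p (z t)].

Definition Delta_chart k := forall (p : mpoint R k) y X,
  Delta k (chart p y) X <-> exists a b c, X = dchart p y (tdir p y a b c).

Lemma lift_velocity k (p : mpoint R k) (c : R -> mpoint R k) y :
  liftable k -> curve_in (Z k) c -> c 0 = chart p y ->
  exists phi z, [/\ reparam phi, smooth_env z, forall t, c (phi t) = chart p (z t),
    agree k (z 0) y & derive1 c 0 = dchart p y (fun i => derive1 (fun t => z t i) 0)].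
Proof.
move=> L cZ c0; have [phi [z [rphi sz cz]]] := L _ _ _ cZ c0; exists phi, z.
have zy : agree k (z 0) y.
  by apply: (@chart_inj _ k p); rewrite -cz -c0; case: rphi => _ ->.
split=> //; rewrite -(derive1_reparam _ rphi); last by apply/smoothP; case: cZ.
have -> : c \o phi = fun t => chart p (z t) by apply/funext.
by rewrite (ddir_chain 0 (ratmap_chart p) sz); exact: dchart_ext.
Qed.

Lemma chart_in_step k (p : mpoint R k.+1) y : Delta_chart k ->
  (forall q z, Z k (chart q z)) -> Z k.+1 (chart p y).
Proof.
move=> D Zk; exists (chart (base_pt p) y), (dchart (base_pt p) y (wfield p y)).
split=> //; last exact/dchart_wfield_neq0/dchart_inj0.
by apply/D; rewrite wfieldS; do 3!eexists.
Qed.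

Lemma line_curve k (p : mpoint R k) y e (B : set (mpoint R k)) :
  (forall t, B (chart p (fun i => y i + t * e i))) ->
  tangent B (chart p y) (dchart p y e).
Proof.
move=> HB; exists (fun t => chart p (fun i => y i + t * e i)); split=> //.
  by split=> //; apply/smoothP; apply: smooth_chart; exact: smooth_line.
by congr (chart p _); apply/funext => i; rewrite mul0r addr0.
Qed.

(* A vector of [Delta^1] is recovered from the velocity of a lift. *)
Lemma tdir_velocity k (p : mpoint R k.+1) y e :
  line_of (chart p y) (base_pt (dchart p y e)) ->
  exists a, agree k.+1 e (tdir p y a (e k.*2.+3) (e k.*2.+4)).
Proof.
move=> /line_of_chart[a]; rewrite base_dchart => /dchart_inj ea; exists a => i.
have [ik _|ki ik] := ltnP i k.*2.+3; first by rewrite ea // tdir_lt.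
have {ik ki} [->|->] : i = k.*2.+3 \/ i = k.*2.+4 by lia.
  by rewrite (tdir_u p).
by rewrite (tdir_v p).
Qed.

Lemma line_of_tdir k (p : mpoint R k.+1) y a b c :
  line_of (chart p y) (base_pt (dchart p y (tdir p y a b c))).
Proof.
apply/line_of_chart; exists a; rewrite base_dchart; apply: dchart_ext => // i ik.
by rewrite tdir_lt.
Qed.

Lemma Delta_chart_step k : liftable k.+1 ->
  (forall (q : mpoint R k.+1) z, Z k.+1 (chart q z)) -> Delta_chart k.+1.
Proof.
move=> L Zk p y X; split=> [[[c [cZ c0 <-]]]|[a [b [c ->]]]].
  have [phi [z [_ sz _ _ ->]]] := lift_velocity L cZ c0.
  by move=> /tdir_velocity[a ea]; do 3!eexists; exact: dchart_ext ea.
split; last exact: line_of_tdir.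
exact: (@line_curve k.+1 p y _ (Z k.+1) (fun t => Zk p _)).
Qed.

Lemma smooth_tdir k (p : mpoint R k) (y : R -> env) a b c : smooth_env y ->
  smooth_mx (fun t => dchart p (y t) (tdir p (y t) a b c)).
Proof.
move=> sy; apply: (@ratmap_smooth _ _ (fun z => dchart p z (tdir p z a b c))) => //.
apply: ratmap_ddir; [exact: ratmap_chart|exact: ratfield_id|move=> i].
rewrite /tdir /dir; do ![apply: ratfun_add|apply: ratfun_mul|exact: ratfun_cst|
  exact: ratfield_wfield].
Qed.

Lemma dchart_tdirD k (p : mpoint R k) y a b c :
  dchart p y (tdir p y a b c) = a *: dchart p y (tdir p y 1 0 0) +
   (b *: dchart p y (tdir p y 0 1 0) + c *: dchart p y (tdir p y 0 0 1)).
Proof.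
have := dchart_lin p y a 1 (tdir p y 1 0 0)
  (fun i => b * tdir p y 0 1 0 i + c * tdir p y 0 0 1 i).
rewrite (dchart_lin p y b c) scale1r => <-; congr (dchart p y _).
by apply/funext => i; rewrite /tdir /dir; ring.
Qed.

(** The frame dual to (df_k, du_k, dv_k) forms a smooth 3-row matrix with independent rows, so
    [smooth_mx_coef] applies. *)
Lemma smooth_coefs k (p : mpoint R k) (y : R -> env) (A B C : R -> R) :
  smooth_env y ->
  smooth_mx (fun t => dchart p (y t) (tdir p (y t) (A t) (B t) (C t))) ->
  [/\ smooth1 A, smooth1 B & smooth1 C].
Proof.
move=> sy sr.
pose e t (i : 'I_3) : mpoint R k := dchart p (y t) (match (i : nat) with
  0 => tdir p (y t) 1 0 0 | 1 => tdir p (y t) 0 1 0 | _ => tdir p (y t) 0 0 1 end).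
pose E t : 'M[R]_(3, mdim k) := \matrix_i e t i.
pose x t : 'rV[R]_3 := \row_i coef_pivot i (A t) (B t) (C t).
pose i0 : 'I_3 := ord0; pose i1 : 'I_3 := lift ord0 ord0.
pose i2 : 'I_3 := lift ord0 (lift ord0 ord0).
have xE (z : 'rV[R]_3) t : z *m E t = dchart p (y t)
    (tdir p (y t) (z 0 i0) (z 0 i1) (z 0 i2)).
  by rewrite dchart_tdirD mulmx_sum_row !big_ord_recl big_ord0 addr0 !rowK.
have sE : smooth_mx E.
  move=> i j; under eq_fun do rewrite mxE.
  rewrite /e; case: (i : nat) => [|[|?]]; exact: smooth_tdir.
have sx : smooth_mx x.
  apply: (smooth_mx_coef sE) => [t z|].
    rewrite xE => /dchart_inj0 z0; have fp := fidx_le p; apply/rowP => i.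
    have := z0 (fidx p) ltac:(lia); have := z0 k.*2.+1 ltac:(lia).
    have := z0 k.*2.+2 ltac:(lia); rewrite tdir_f tdir_u tdir_v mxE => z2 z1 z00.
    case: i => -[|[|[|//]]] i3; [rewrite -[RHS]z00|rewrite -[RHS]z1|rewrite -[RHS]z2];
      by congr (z 0 _); exact/val_inj.
  suff -> : (fun t => x t *m E t) =
    (fun t => dchart p (y t) (tdir p (y t) (A t) (B t) (C t))) by [].
  by apply/funext => t; rewrite xE !mxE.
split; [have := sx 0 i0|have := sx 0 i1|have := sx 0 i2];
  by under eq_fun do rewrite mxE.
Qed.

(** Lift the base curve first, then choose a smooth spanning vector of the moving line. The
    quotients of its components by the pivot component are the two new coordinates. *)
Lemma lift_step k : liftable k -> Delta_chart k -> liftable k.+1.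
Proof.
move=> L D p c y0 [sc cZ] c0; have sc' : smooth_mx c by exact/smoothP.
set b := base_pt p.
have bZ : curve_in (Z k) (fun t => base_pt (c t)).
  split; first exact/smoothP/smooth_base.
  by move=> t; have [q [w [qZ _ _ ->]]] := cZ t; rewrite base_pair_line.
have [|phi [y [rphi sy cy]]] := L b _ y0 bZ; first by rewrite c0 base_chart.
have [sphi phi0 _] := rphi.
have y00 : agree k (y 0) y0.
  by apply: (@chart_inj _ k b); rewrite -cy phi0 c0 base_chart.
have sc2 : smooth_mx (c \o phi) by move=> i l; exact: smooth1_comp (sc' i l) sphi.
pose P t : 'M[R]_(mdim k) := vec_mx (rsubmx ((c \o phi) t)).
have sP : smooth_mx P by exact: vec_smooth.
have Pw t : exists w, [/\ Delta k (chart b (y t)) w, w != 0, P t = line_proj w &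
    c (phi t) = pair_line (chart b (y t)) w].
  have [q [w [qZ qw w0 E]]] := cZ (phi t); exists w.
  have qE : q = chart b (y t) by rewrite -cy E base_pair_line.
  by split; rewrite -?qE // /P /= E row_mxKr mxvecK.
(* [w0] spans the line at parameter 0; its projection onto the line at parameter t is smooth in
   t. *)
pose w0 := dchart b y0 (wfield p y0).
have w00 : w0 != 0 by exact/dchart_wfield_neq0/dchart_inj0.
have /choice[x Hx] t : exists x : R * R * R, w0 *m P t =
    dchart b (y t) (tdir b (y t) x.1.1 x.1.2 x.2).
  have [w [/D[a1 [a2 [a3 wE]]] _ -> _]] := Pw t.
  rewrite mul_line_proj; set l := _ * _; exists (l * a1, l * a2, l * a3).
  rewrite wE -dchartZ; congr (dchart b _ _); apply/funext => i.
  by rewrite /tdir /dir /=; ring.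
pose A t := (x t).1.1; pose B t := (x t).1.2; pose C t := (x t).2.
have [sA sB sC] : [/\ smooth1 A, smooth1 B & smooth1 C].
  apply: (@smooth_coefs k b y) => //.
  suff -> : (fun t => dchart b (y t) (tdir b (y t) (A t) (B t) (C t))) =
     (fun t => w0 *m P t).
    by apply: smooth_mx_mul => // i j; exact: smooth1_cst.
  by apply/funext => t; rewrite Hx.
pose s := pivot p.
pose N t := coef_pivot s (A t) (B t) (C t).
have sN : smooth1 N by rewrite /N; case: (s) => [|[|?]].
(* At parameter 0 the projection fixes [w0], whose pivot component is 1. *)
have N0 : N 0 != 0.
  have := Hx 0; rewrite /P /= phi0 c0 chartS row_mxKr mxvecK line_projK //.
  rewrite -/b (tdir_ext b _ _ _ y00) (dchart_ext b y00 (fun i _ => erefl)).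
  move=> /dchart_inj WE.
  have fb := fidx_le b.
  have := WE (fidx b) ltac:(lia); have := WE k.*2.+1 ltac:(lia).
  have := WE k.*2.+2 ltac:(lia).
  rewrite wfieldS !tdir_f !tdir_u !tdir_v /N /A /B /C /s.
  by case: (pivot p) => [|[|?]] /= E3 E2 E1; rewrite -?E1 -?E2 -?E3 oner_eq0.
have [psi rpsi Npsi] := reparam_neq0 sN N0; have [spsi _ _] := rpsi.
exists (phi \o psi), (fun t => let t' := psi t in
  extend k (y t') (coef_fst s (A t') (B t') (C t') / N t')
   (coef_snd s (A t') (B t') (C t') / N t')).
have sp f : smooth1 f -> smooth1 (fun t => f (psi t)).
  by move=> sf; exact: smooth1_comp sf spsi.
split; first exact: reparam_comp.
- move=> i; rewrite /extend; have sNi : smooth1 (fun t => (N (psi t))^-1).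
    by apply: smooth1_inv => //; exact: sp.
  case: eqP => _; [|case: eqP => _; last exact: (sp (fun t => y t i))];
    apply: smooth1_mul => //; case: (s) => [|[|?]] /=; exact: sp.
move=> t; set t' := psi t.
apply: etrans _ (esym (@chart_extend k p (y t') (A t') (B t') (C t') (Npsi t))).
have [w [_ wn0 Pt E]] := Pw t'; rewrite /= -/t' E; apply: eq_pair_line => //.
(* If [w0] projected to 0, all three components would vanish, [N] among them. *)
rewrite -Hx Pt mul_line_proj line_projZ //; apply: contraNneq (Npsi t) => l0.
have := Hx t'; rewrite Pt mul_line_proj l0 scale0r => /esym/dchart_inj0 T0.
have fb := fidx_le b.
have := T0 (fidx b) ltac:(lia); have := T0 k.*2.+1 ltac:(lia).
have := T0 k.*2.+2 ltac:(lia); rewrite !tdir_f !tdir_u !tdir_v.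
by rewrite -/(A t') -/(B t') -/(C t') /N -/t'; case: (s) => [|[|?]] /= E3 E2 E1; apply/eqP.
Qed.

Lemma lift0 : liftable 0.
Proof.
move=> p c y [/smoothP sc _] _; exists id, (fun t i => c t 0 (inord i)).
split; [exact: reparam_id|by move=> i; exact: sc|move=> t].
by apply/rowP => i; rewrite mxE inord_val.
Qed.

Lemma Delta0 : Delta_chart 0.
Proof.
move=> p y X; split=> // _; exists (X 0 0), (X 0 (inord 1)), (X 0 (inord 2)).
rewrite dchart0; apply/rowP => -[[|[|[|//]]] i3]; rewrite !mxE.
- by rewrite -[0%N]/(fidx p) tdir_f; congr (X 0 _); exact/val_inj.
- by rewrite (tdir_u p); congr (X 0 _); apply/val_inj; rewrite /= inordK.
- by rewrite (tdir_v p); congr (X 0 _); apply/val_inj; rewrite /= inordK.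
Qed.

(** Lifting at level k + 1 uses the frame of the distribution at level k, and that frame at level k
    + 1 is then found from velocities of lifted curves. *)
Lemma lift_Delta k : [/\ liftable k, Delta_chart k & forall p y, Z k (chart p y)].
Proof.
elim: k => [|k [L D Zk]]; first by split=> //; [exact: lift0|exact: Delta0].
have L1 := lift_step L D.
have Z1 p y : Z k.+1 (chart p y) by exact: chart_in_step.
by split=> //; exact: Delta_chart_step.
Qed.

Lemma Z_chart k (p : mpoint R k) y : Z k (chart p y).
Proof. by have [_ _] := lift_Delta k. Qed.

Lemma DeltaP k (p : mpoint R k) y X :
  Delta k (chart p y) X <-> exists a b c, X = dchart p y (tdir p y a b c).
Proof. by have [_ D _] := lift_Delta k; exact: D. Qed.

Lemma lift_curve k (p : mpoint R k) (c : R -> mpoint R k) y :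
  curve_in (Z k) c -> c 0 = chart p y ->
  exists phi z, [/\ reparam phi, smooth_env z, forall t, c (phi t) = chart p (z t),
    agree k (z 0) y & derive1 c 0 = dchart p y (fun i => derive1 (fun t => z t i) 0)].
Proof. by have [L _ _] := lift_Delta k; exact: lift_velocity. Qed.

(** A straight line of coordinates supplies one admissible curve. Any other admissible curve lifts,
    and injectivity of [dchart] forces its lift to have the same velocity, so the chosen value is
    unique. *)
Lemma differential_chart k (p : mpoint R k) (G : mpoint R k -> R) j y e :
  (j < k.*2.+3)%N -> (forall z, G (chart p z) = z j) ->
  differential_on (Z k) G (chart p y) (dchart p y e) = e j.
Proof.
move=> jk GE; rewrite /differential_on; apply: xget_unique => [|a].
  exists (fun t => chart p (fun i => y i + t * e i)); split=> //.
  - by split=> [|t]; [apply/smoothP; apply: smooth_chart; exact: smooth_line|exact: Z_chart].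
  - by congr (chart p _); apply/funext => i; rewrite mul0r addr0.
  - have -> : G \o (fun t => chart p (fun i => y i + t * e i)) =
        fun t => y j + t * e j by apply/funext => t; rewrite /= GE.
    rewrite -[X in is_derive _ _ _ X](derive1_line (y j) (e j) 0).
    exact/smooth1_is_derive/(smooth_line y e j).
move=> [c [cZ c0 cX da]].
have [phi [z [[sphi phi0 dphi] sz cz zy]]] := lift_curve cZ c0.
rewrite cX => /dchart_inj ->//.
have -> : (fun t => z t j) = (G \o c) \o phi by apply/funext => t; rewrite /= cz GE.
apply/esym/is_derive1E; rewrite -[X in is_derive _ _ _ X]mulr1.
by apply: is_derive1_comp; rewrite phi0.
Qed.

(** * Kumpera-Rubin functions in a chart, and surjectivity *)

Definition cidx k (p : mpoint R k) (g : nat) : nat :=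
  match g with 0 => fidx p | 1 => k.*2.+1 | _ => k.*2.+2 end.

Lemma cidx_lt k (p : mpoint R k) g : (cidx p g < k.*2.+3)%N.
Proof. by have := fidx_le p; case: g => [|[|g]] /=; lia. Qed.

Lemma tdir_cidx k (p : mpoint R k) y g a b c :
  tdir p y a b c (cidx p g) = coef_pivot g a b c.
Proof. by case: g => [|[|g]] /=; rewrite ?tdir_f ?tdir_u ?tdir_v. Qed.

Definition KRc k (p : mpoint R k) (g : nat) : mpoint R k -> R :=
  match g with 0 => (KR p).1.1 | 1 => KR_u p | _ => KR_v p end.

Lemma ratio_chart k (p : mpoint R k.+1) G F j y :
  (j < k.*2.+3)%N -> (forall z, G (chart (base_pt p) z) = z j) ->
  (forall z, F (chart (base_pt p) z) = z (fidx p)) ->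
  Defs.ratio G F (chart p y) = wfield p y j.
Proof.
move=> jk GE FE; have fk : (fidx p < k.*2.+3)%N by have := fidx_le p; lia.
rewrite /Defs.ratio; apply: xget_unique => [w /line_of_chart[a ->]|a Ha].
  by rewrite base_chart (differential_chart _ _ jk GE) (differential_chart _ _ fk FE) wfield_f mulr1 mulrC.
have := Ha (dchart (base_pt p) y (fun i => 1 * wfield p y i)).
rewrite base_chart (differential_chart _ _ jk GE) (differential_chart _ _ fk FE).
by rewrite wfield_f !mul1r mulr1 => <- //; apply/line_of_chart; exists 1.
Qed.

(* The positions in [(f, u, v)] of the three functions called [f_{k+1}, g, h] in
   the definition of the Kumpera-Rubin coordinates. *)
Definition pos_pivot (s : nat) : nat := match s with 0 => 0 | 1 => 1 | _ => 2 end.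
Definition pos_fst (s : nat) : nat := if s is 0 then 1 else 0.
Definition pos_snd (s : nat) : nat := match s with 0 | 1 => 2 | _ => 1 end.

Lemma KRcS k (p : mpoint R k.+1) g : KRc p g =
  match g with
  | 0 => KRc (base_pt p) (pos_pivot (pivot p)) \o
           (fun q : mpoint R k.+1 => base_pt q)
  | 1 => Defs.ratio (KRc (base_pt p) (pos_fst (pivot p)))
           (KRc (base_pt p) (pos_pivot (pivot p)))
  | _ => Defs.ratio (KRc (base_pt p) (pos_snd (pivot p)))
           (KRc (base_pt p) (pos_pivot (pivot p)))
  end.
Proof.
rewrite /KRc /KR_u /KR_v /pivot /=; case: (KR (base_pt p)) => -[f u] v.
by rewrite -!/(nonzero_on_line p _); case: nonzero_on_line;
  [|case: nonzero_on_line]; case: g => [|[|g]].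
Qed.

Lemma fidxS k (p : mpoint R k.+1) :
  fidx p = cidx (base_pt p) (pos_pivot (pivot p)).
Proof. by rewrite /=; case: (pivot p) => [|[|s]]. Qed.

Lemma KR_chart k (p : mpoint R k) g y : KRc p g (chart p y) = y (cidx p g).
Proof.
elim: k p g y => [|k IHk] p g y.
  by case: g => [|[|g]]; rewrite /KRc /KR_u /KR_v /= mxE inordK.
have FE z : KRc (base_pt p) (pos_pivot (pivot p)) (chart (base_pt p) z) = z (fidx p).
  by rewrite fidxS; exact: IHk.
rewrite KRcS; case: g => [|g]; first by rewrite [LHS]/= base_chart FE.
have wE h : wfield p y (cidx (base_pt p) h) =
    coef_pivot h (coef_f (pivot p) 1 (y k.*2.+3) (y k.*2.+4))
    (coef_u (pivot p) 1 (y k.*2.+3) (y k.*2.+4))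
    (coef_v (pivot p) 1 (y k.*2.+3) (y k.*2.+4)).
  by rewrite wfieldS tdir_cidx.
case: g => [|g]; rewrite (ratio_chart y (cidx_lt _ _) (IHk (base_pt p) _) FE) wE;
  by case: (pivot p) => [|[|s]].
Qed.

Lemma differential_KR k (p : mpoint R k) g y a b c :
  differential_on (Z k) (KRc p g) (chart p y) (dchart p y (tdir p y a b c)) =
  coef_pivot g a b c.
Proof.
rewrite (@differential_chart _ _ _ (cidx p g)) ?cidx_lt ?tdir_cidx //.
by move=> z; exact: KR_chart.
Qed.

Lemma nonzero_on_lineE k (p : mpoint R k.+1) y a b c g :
  base_pt p = chart (base_pt p) y ->
  (forall v, line_of p v <->
     exists l, v = l *: dchart (base_pt p) y (tdir (base_pt p) y a b c)) ->
  nonzero_on_line p (KRc (base_pt p) g) = (coef_pivot g a b c != 0).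
Proof.
move=> bE lE.
have dE l : differential_on (Z k) (KRc (base_pt p) g) (base_pt p)
    (l *: dchart (base_pt p) y (tdir (base_pt p) y a b c)) =
    l * coef_pivot g a b c.
  rewrite [X in differential_on _ _ X]bE -dchartZ.
  rewrite (@differential_chart _ _ _ (cidx (base_pt p) g)) ?cidx_lt ?tdir_cidx //.
  by move=> z; exact: KR_chart.
apply/asboolP/idP => [[v /lE[l ->]]|n0]; first by rewrite dE mulf_eq0 negb_or => /andP[].
by exists (1 *: dchart (base_pt p) y (tdir (base_pt p) y a b c));
  [apply/lE; exists 1|rewrite dE mul1r].
Qed.

Lemma pivotE k (p : mpoint R k.+1) : pivot p =
  if nonzero_on_line p (KRc (base_pt p) 0) then 0
  else if nonzero_on_line p (KRc (base_pt p) 1) then 1 else 2.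
Proof. by rewrite /pivot /KRc /KR_u; case: (KR (base_pt p)) => -[f u] v. Qed.

(** The pivot is by definition a position where the line of [p] has a nonzero component, so the
    chart built from [p] does reach [p]. *)
Lemma chart_surj k (p : mpoint R k) : Z k p -> exists y, p = chart p y.
Proof.
elim: k p => [|k IHk] p.
  by exists (fun i => p 0 (inord i)); apply/rowP => i; rewrite mxE inord_val.
move=> [q [w [qZ qw w0 pE]]]; have qb : base_pt p = q by rewrite pE base_pair_line.
rewrite -qb in qZ qw pE; have [y yE] := IHk _ qZ.
move: qw; rewrite [X in Delta k X]yE => /DeltaP[a [b [c wE]]].
have nz g : nonzero_on_line p (KRc (base_pt p) g) = (coef_pivot g a b c != 0).
  apply: (nonzero_on_lineE _ yE) => v; rewrite -wE [in line_of _]pE.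
  exact: line_of_pair.
have N0 : coef_pivot (pivot p) a b c != 0.
  rewrite pivotE !nz /=; case: (eqVneq a 0) => //= a0.
  case: (eqVneq b 0) => //= b0; apply: contra_neq w0 => c0.
  rewrite wE a0 b0 c0 -(scale0r (dchart (base_pt p) y (fun=> 0))) -dchartZ.
  by congr (dchart _ _ _); apply/funext => i; rewrite /tdir /dir !mul0r !addr0.
have := chart_extend y N0; rewrite -wE -yE -pE => /esym E.
by eexists; exact: E.
Qed.

(** The pivot is the first nonzero position, which constrains the coordinates of [p] itself: u = 0
    for pivot 1, and u = v = 0 for pivot 2. *)
Lemma pivot_chart k (p : mpoint R k.+1) y : p = chart p y ->
  let s := pivot p in let u := y k.*2.+3 in let v := y k.*2.+4 in
  s = if coef_f s 1 u v != 0 then 0 else if coef_u s 1 u v != 0 then 1 else 2.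
Proof.
move=> pE /=; have bE : base_pt p = chart (base_pt p) y by rewrite -base_chart -pE.
have nz g := @nonzero_on_lineE k p y (coef_f (pivot p) 1 (y k.*2.+3) (y k.*2.+4))
  (coef_u (pivot p) 1 (y k.*2.+3) (y k.*2.+4))
  (coef_v (pivot p) 1 (y k.*2.+3) (y k.*2.+4)) g bE.
rewrite -wfieldS in nz.
rewrite {1}pivotE !nz // => v; rewrite [in line_of _]pE line_of_chart;
  by split=> -[a ->]; exists a; rewrite dchartZ.
Qed.

End Lift.

(** * Baby monsters in a chart *)

Section Baby.
Local Open Scope classical_set_scope.
Local Open Scope ring_scope.
Context {R : realType}.
Local Notation env := (nat -> R).
Local Notation Z k := (carrier (monster R k)).
Local Notation Delta k := (distr (monster R k)).

Lemma Z_base k (p : mpoint R k.+1) : Z k.+1 p -> Z k (base_pt p).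
Proof. by case=> q [w [qZ _ _ ->]]; rewrite base_pair_line. Qed.

Lemma baby_birth k (p : mpoint R k.+1) :
  baby k.+1 p = DistManifold (fiber p) (tangent (fiber p)).
Proof. by rewrite /= eqxx. Qed.

Lemma baby_prolong k (p : mpoint R k.+1) i : i <> k.+1 ->
  baby i p = prolong (baby i (base_pt p)).
Proof. by move=> /eqP ik; rewrite /= eq_sym (negbTE ik). Qed.

Lemma tangentS n (A B : set 'rV[R]_n) q X : A `<=` B -> tangent A q X -> tangent B q X.
Proof.
by move=> AB [c [[sc cA] c0 cX]]; exists c; split=> //; split=> // t; exact: AB.
Qed.

Lemma line_of0 n (q : 'rV[R]_(n + n * n)) : line_of q 0.
Proof. exact: sub0mx. Qed.

Lemma baby_sub k (p : mpoint R k) i : carrier (baby i p) `<=` Z k /\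
  forall q, distr (baby i p) q `<=` Delta k q.
Proof.
elim: k p => [|k IHk] p; first by split=> //= ? [].
have [->|/eqP ik] := eqVneq i k.+1.
  rewrite baby_birth; split=> [q []//|q X /= tX].
  split; first by apply: tangentS tX => ? [].
  have [c [[sc cF] c0 <-]] := tX; rewrite base_derive1; last exact/smoothP.
  have -> : (fun t => base_pt (c t)) = (fun=> base_pt p).
    by apply/funext => t; have [_ ->] := cF t.
  by rewrite derive1_cst; exact: line_of0.
rewrite baby_prolong //; have [cZ dD] := IHk (base_pt p).
have sub : carrier (prolong (baby i (base_pt p))) `<=` Z k.+1.
  by move=> _ [b [w [bZ bw w0 ->]]]; exists b, w; split=> //; [exact: cZ|exact: dD].
by split=> // q X [tX lX]; split=> //; exact: tangentS tX.
Qed.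

(** The old function number [g] yields the new fiber coordinate at this position. The value at g = s
    is a dummy: the pivot component of the line is 1, so the line never lies in that plane. *)
Definition next_pos (s g : nat) : nat :=
  match s, g with
  | 0, 1 => 1 | 0, _ => 2 | _, 0 => 1 | _, _ => 2
  end.

Lemma coef_next s g (u0 v0 : R) :
  coef_pivot g (coef_f s 1 u0 v0) (coef_u s 1 u0 v0) (coef_v s 1 u0 v0) = 0 ->
  (next_pos s g = 1%N \/ next_pos s g = 2%N) /\ forall x u v : R,
  coef_pivot g (coef_f s 1 u v) (coef_u s 1 u v) (coef_v s 1 u v) =
  coef_pivot (next_pos s g) x u v.
Proof.
case: s => [|[|s]]; case: g => [|[|g]] /= E; (split; [by [left|right]|]) => //;
  by move/eqP: E; rewrite oner_eq0.
Qed.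

(* Near [p = chart p y0] the baby monster born at level [i] is given by freezing
   some of the coordinates, and its planes by [dg = 0] for a single coordinate
   [g], which is [f_k], [u_k] or [v_k] when [g] is [0], [1] or [2]. *)
Definition baby_chart k (p : mpoint R k) (i g : nat) (y0 : env) : Prop :=
  exists A : nat -> Prop, let on (y : env) := forall j, A j -> y j = y0 j in
  [/\ forall j, A j -> (j < k.*2.+3)%N,
      forall y, carrier (baby i p) (chart p y) <-> on y,
      forall y X, on y -> (distr (baby i p) (chart p y) X <->
        exists a b c, coef_pivot g a b c = 0 /\ X = dchart p y (tdir p y a b c)) &
      forall y a b c j, on y -> A j -> coef_pivot g a b c = 0 ->
        tdir p y a b c j = 0].

(** A curve in the baby monster lifts to coordinates whose frozen entries are constant, hence have
    derivative 0. *)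
Lemma baby_velocity k (p : mpoint R k.+1) i y y0 (A : nat -> Prop) X :
  (forall z, carrier (baby i p) (chart p z) -> forall j, A j -> z j = y0 j) ->
  tangent (carrier (baby i p)) (chart p y) X ->
  exists2 e, (forall j, A j -> e j = 0) & X = dchart p y e.
Proof.
move=> on [c [[sc cB] c0 <-]].
have cZ : curve_in (Z k.+1) c.
  by split=> // t; have [sub _] := baby_sub p i; apply: sub; exact: cB.
have [phi [z [_ sz cz _ ->]]] := lift_curve cZ c0.
eexists; last by [].
move=> j Aj /=; have -> : (fun t => z t j) = (fun=> y0 j).
  by apply/funext => t; apply: on Aj; rewrite -cz; exact: cB.
exact: derive1_cst.
Qed.

(** The fiber freezes exactly the coordinates of the lower level. *)
Lemma baby_chart_birth k (p : mpoint R k.+1) y0 : p = chart p y0 ->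
  baby_chart p k.+1 0 y0.
Proof.
move=> pE; exists (fun j => (j < k.*2.+3)%N).
have bE : base_pt p = chart (base_pt p) y0 by rewrite -base_chart -pE.
have on y : carrier (baby k.+1 p) (chart p y) <-> agree k y y0.
  rewrite baby_birth; split=> [[_]|yy0].
    by rewrite base_chart [RHS]bE => /chart_inj.
  by split; [exact: Z_chart|rewrite base_chart [RHS]bE; exact: chart_ext].
have off y b c j : (j < k.*2.+3)%N -> tdir p y 0 b c j = 0.
  by move=> jk; rewrite tdir_lt // mul0r.
split=> [j jk|y|y X yon|y a b c j _ jk /= ->]; [by lia|exact: on| |exact: off].
rewrite baby_birth; split=> [X_in|[a [b [c [/= -> ->]]]]].
  have [||e e0 ->] := @baby_velocity k p k.+1 y y0 (fun j => (j < k.*2.+3)%N) X.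
  - by move=> z /on.
  - by rewrite baby_birth; exact: X_in.
  exists 0, (e k.*2.+3), (e k.*2.+4); split; first exact: erefl.
  apply: dchart_ext => // j jk; have [jk'|kj] := ltnP j k.*2.+3.
    by rewrite off // e0.
  have {jk kj} [->|->] : j = k.*2.+3 \/ j = k.*2.+4 by lia.
    by rewrite (tdir_u p).
  by rewrite (tdir_v p).
apply: (@line_curve R k.+1 p y _ (fiber p)) => t.
have /on : agree k (fun j => y j + t * tdir p y 0 b c j) y0.
  by move=> j jk; rewrite off // mulr0 addr0 yon.
by rewrite baby_birth.
Qed.

Lemma wfield_line_of k (p : mpoint R k.+1) y :
  line_of (chart p y) (dchart (base_pt p) y (wfield p y)).
Proof. by apply/line_of_chart; exists 1; congr (dchart _ y _); apply/funext => i; rewrite mul1r. Qed.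

(** A line lies in the plane dg = 0 exactly when one new fiber coordinate, the one at position
    [next_pos], vanishes. Prolongation therefore freezes this coordinate at 0, and its differential
    cuts out the new plane. *)
Lemma baby_chart_step k (p : mpoint R k.+1) i g y0 : i <> k.+1 ->
  p = chart p y0 -> baby_chart (base_pt p) i g y0 ->
  coef_pivot g (coef_f (pivot p) 1 (y0 k.*2.+3) (y0 k.*2.+4))
    (coef_u (pivot p) 1 (y0 k.*2.+3) (y0 k.*2.+4))
    (coef_v (pivot p) 1 (y0 k.*2.+3) (y0 k.*2.+4)) = 0 ->
  baby_chart p i (next_pos (pivot p) g) y0.
Proof.
move=> ik pE [A [Alt cA dA tA]] g0.
have [nE cE] := coef_next g0; set n := next_pos _ g in nE cE *.
have cn (y : env) x : coef_pivot n x (y k.*2.+3) (y k.*2.+4) = y (cidx p n).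
  by case: nE => ->.
have Wg (y : env) : coef_pivot g (coef_f (pivot p) 1 (y k.*2.+3) (y k.*2.+4))
    (coef_u (pivot p) 1 (y k.*2.+3) (y k.*2.+4))
    (coef_v (pivot p) 1 (y k.*2.+3) (y k.*2.+4)) = y (cidx p n).
  by rewrite -(cn y 0); exact: cE.
have y0n : y0 (cidx p n) = 0 by rewrite -Wg.
pose A' j := A j \/ j = cidx p n.
have onP (y : env) : (forall j, A' j -> y j = y0 j) <->
    (forall j, A j -> y j = y0 j) /\ y (cidx p n) = 0.
  split=> [H|[H1 H2] j [/H1|->]//]; last by rewrite H2.
  by split=> [j Aj|]; [apply: H; left|rewrite H ?y0n //; right].
have on y : carrier (baby i p) (chart p y) <-> forall j, A' j -> y j = y0 j.
  rewrite baby_prolong // onP; split=> [[q [w [qB qw w0 E]]]|[yA yn]].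
    have qE : q = chart (base_pt p) y by rewrite -base_chart E base_pair_line.
    rewrite qE in qB qw; have yA := (cA y).1 qB; split=> //.
    have [a [b [c [abc wE]]]] := (dA y w yA).1 qw.
    have /line_of_chart[l wl] : line_of (chart p y) w.
      by rewrite E; apply/line_of_pair => //; exists 1; rewrite scale1r.
    have l0 : l != 0.
      by apply: contra_neq w0 => l0; rewrite wl dchartZ l0 scale0r.
    move: wl; rewrite wE => /dchart_inj/(_ _ (cidx_lt (base_pt p) g)).
    rewrite tdir_cidx abc wfieldS tdir_cidx Wg => /esym/eqP.
    by rewrite mulf_eq0 (negbTE l0) => /eqP.
  exists (chart (base_pt p) y), (dchart (base_pt p) y (wfield p y)); split.
  - exact/cA.
  - apply/(dA _ _ yA); rewrite wfieldS; do 3!eexists.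
    by split; last reflexivity; rewrite Wg.
  - exact/dchart_wfield_neq0/dchart_inj0.
  - exact: chartS.
(* Lower entries of the vector are a multiple of [wfield p y], which lies in the old plane since the
   new frozen coordinate is 0. This makes the straight lines used below stay in the baby monster. *)
have tA' y a b c j : (forall j, A' j -> y j = y0 j) -> A' j ->
    coef_pivot n a b c = 0 -> tdir p y a b c j = 0.
  move=> /onP[yA yn] [Aj|->] abc; last by rewrite tdir_cidx.
  rewrite tdir_lt ?wfieldS; last by have := Alt j Aj; lia.
  by rewrite (tA _ _ _ _ _ yA Aj) ?mulr0 // Wg.
exists A'; split=> // [j [/Alt|->]|y X yA]; [by lia|exact: cidx_lt|].
split=> [|[a [b [c [abc ->]]]]].
  rewrite {1}baby_prolong // => -[tX lX].
  have [||e e0 XE] := @baby_velocity k p i y y0 A' X.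
  - by move=> z /on.
  - by rewrite baby_prolong.
  move: lX; rewrite XE => /tdir_velocity[a ea].
  exists a, (e k.*2.+3), (e k.*2.+4); split; last exact: dchart_ext.
  by rewrite cn e0 //; right.
have : tangent (carrier (baby i p)) (chart p y) (dchart p y (tdir p y a b c)).
  apply: (@line_curve R k.+1 p y _ (carrier (baby i p))) => t.
  by apply/on => j Aj; rewrite tA' // mulr0 addr0 yA.
by rewrite baby_prolong // => tX; split; [exact: tX|exact: line_of_tdir].
Qed.

(** Asking this of every coordinate vector of [p] avoids carrying a choice; it is vacuous off the
    tower, so [Z k p] is assumed wherever information is extracted. *)
Definition born k (p : mpoint R k) i g := forall y, p = chart p y -> baby_chart p i g y.

Definition plane k (p : mpoint R k) g := kernel_plane p (KRc p g).

Lemma planeP k (p : mpoint R k) g y a b c : p = chart p y ->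
  plane p g (dchart p y (tdir p y a b c)) <-> coef_pivot g a b c = 0.
Proof.
move=> pE; have D X : distr (monster R k) p X <->
    exists a b c, X = dchart p y (tdir p y a b c).
  by rewrite [X in distr _ X]pE; exact: DeltaP.
have dK : differential_on (Z k) (KRc p g) p (dchart p y (tdir p y a b c)) =
    coef_pivot g a b c.
  by rewrite [X in differential_on _ _ X]pE; exact: differential_KR.
rewrite /plane /kernel_plane /= dK; split=> [[]//|abc]; split=> //.
by apply/D; do 3!eexists.
Qed.

Lemma plane_dir k (p : mpoint R k) g y X : p = chart p y -> plane p g X ->
  exists a b c, coef_pivot g a b c = 0 /\ X = dchart p y (tdir p y a b c).
Proof.
move=> pE gX; have [DX _] := gX; move: DX; rewrite [X in distr _ X]pE.
move=> /DeltaP[a [b [c XE]]]; exists a, b, c; split=> //.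
by apply/(planeP g a b c pE); rewrite -XE.
Qed.

Lemma born_distr k (p : mpoint R k) i g : Z k p -> born p i g ->
  carrier (baby i p) p /\ distr (baby i p) p = plane p g.
Proof.
move=> /chart_surj[y pE] /(_ y pE)[A [_ cA dA _]]; split.
  by rewrite [X in carrier _ X]pE; exact/cA.
apply/seteqP; split=> X; rewrite [X in distr _ X]pE dA //.
  by move=> [a [b [c [abc ->]]]]; exact/planeP.
by move=> /(plane_dir pE).
Qed.

Lemma plane_neq k (p : mpoint R k) g h : Z k p -> (g < h < 3)%N ->
  plane p g <> plane p h.
Proof.
move=> /chart_surj[y pE] gh E.
have H a b c : coef_pivot g a b c = 0 <-> coef_pivot h a b c = 0 :> R.
  by rewrite -!(planeP _ _ _ _ pE) E.
have [H1 _] := H 0 1 0; have [H2 _] := H 0 0 1.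
move/andP: gh => [gh h3]; case: g h gh h3 H1 H2 {E H} => [|[|g]] [|[|[|h]]] //= _ _ H1 H2;
  by [move/eqP: (H1 erefl); rewrite oner_eq0|move/eqP: (H2 erefl); rewrite oner_eq0].
Qed.

Lemma born_birth k (p : mpoint R k.+1) : born p k.+1 0.
Proof. by move=> y; exact: baby_chart_birth. Qed.

Lemma line_sub_plane k (p : mpoint R k.+1) g y : p = chart p y ->
  line_of p `<=` plane (base_pt p) g <->
  coef_pivot g (coef_f (pivot p) 1 (y k.*2.+3) (y k.*2.+4))
    (coef_u (pivot p) 1 (y k.*2.+3) (y k.*2.+4))
    (coef_v (pivot p) 1 (y k.*2.+3) (y k.*2.+4)) = 0.
Proof.
move=> pE; have bE : base_pt p = chart (base_pt p) y by rewrite -base_chart -pE.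
rewrite -(planeP _ _ _ _ bE) -wfieldS; split=> [|W v].
  by apply; rewrite [in line_of _]pE; exact: wfield_line_of.
rewrite [in line_of _]pE => /line_of_chart[l ->].
move: W; rewrite wfieldS => /(planeP _ _ _ _ bE) W.
set a := coef_f _ _ _ _ in W *; set b := coef_u _ _ _ _ in W *.
set c := coef_v _ _ _ _ in W *.
have -> : (fun i => l * tdir (base_pt p) y a b c i) =
    tdir (base_pt p) y (l * a) (l * b) (l * c).
  by apply/funext => i; rewrite /tdir /dir; ring.
apply/(planeP _ _ _ _ bE); move: W.
by case: g => [|[|g]] /= ->; rewrite mulr0.
Qed.

Lemma born_step k (p : mpoint R k.+1) i g : i <> k.+1 ->
  born (base_pt p) i g -> line_of p `<=` plane (base_pt p) g ->
  born p i (next_pos (pivot p) g).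
Proof.
move=> ik bg lg y pE; have bE : base_pt p = chart (base_pt p) y by rewrite -base_chart -pE.
by apply: baby_chart_step => //; [exact: bg|exact/line_sub_plane].
Qed.

Lemma baby_line k (p : mpoint R k.+1) i : i <> k.+1 -> carrier (baby i p) p ->
  exists2 w : mpoint R k, carrier (baby i (base_pt p)) (base_pt p) /\
    distr (baby i (base_pt p)) (base_pt p) w &
    forall v, line_of p v -> exists a : R, v = a *: w.
Proof.
move=> ik; rewrite baby_prolong // => -[q [w [qB qw w0 pE]]]; exists w.
  have bE : base_pt p = q by rewrite pE base_pair_line.
  by rewrite -bE in qB qw.
by move=> v; rewrite pE => /(line_of_pair q v w0).
Qed.

Lemma planeZ k (p : mpoint R k) g l X : Z k p -> plane p g X -> plane p g (l *: X).
Proof.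
move=> /chart_surj[y pE] /(plane_dir pE)[a [b [c [abc ->]]]].
rewrite -dchartZ.
have -> : (fun i => l * tdir p y a b c i) = tdir p y (l * a) (l * b) (l * c).
  by apply/funext => i; rewrite /tdir /dir; ring.
apply/(planeP _ _ _ _ pE).
by case: g abc => [|[|g]] /= ->; rewrite mulr0.
Qed.

Lemma next_lt s g : (next_pos s g < 3)%N.
Proof. by case: s g => [|[|s]] [|[|g]]. Qed.

(** The backward step: a baby monster that reaches [p] already reached the point below, with the
    line of [p] inside its plane there. *)
Lemma born_inv k (p : mpoint R k.+1) i : Z k.+1 p -> i <> k.+1 ->
  carrier (baby i p) p -> carrier (baby i (base_pt p)) (base_pt p) /\
  forall g, born (base_pt p) i g -> line_of p `<=` plane (base_pt p) g.
Proof.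
move=> Zp ik /(baby_line ik)[w [cb dw] lw]; split=> // g bg v /lw[l ->].
have Zb := Z_base Zp; apply: planeZ => //.
by have [_ <-] := born_distr Zb bg.
Qed.

Lemma born_ex k (p : mpoint R k) i : Z k p -> carrier (baby i p) p ->
  exists2 g, (g < 3)%N & born p i g.
Proof.
elim: k p => [|k IHk] p Zp cp; first by [].
have [->|/eqP ik] := eqVneq i k.+1; first by exists 0%N => //; exact: born_birth.
have [cb lb] := born_inv Zp ik cp.
have [g g3 bg] := IHk _ (Z_base Zp) cb.
exists (next_pos (pivot p) g); first exact: next_lt.
by apply: born_step => //; exact: lb.
Qed.

End Baby.

(** * Reading the code *)

Section Code.
Local Open Scope classical_set_scope.
Local Open Scope ring_scope.
Context {R : realType}.
Local Notation env := (nat -> R).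
Local Notation Z k := (carrier (monster R k)).

(* [g] is [0], [1] or [2] for [V], [T_1], [T_2], and [i] is the level of birth. *)
Definition present k (p : mpoint R k) (g i : nat) : Prop :=
  [/\ (0 < i)%N, (i <= k)%N & born p i g].

Lemma plane_inj k (p : mpoint R k) g h : Z k p -> (g < 3)%N -> (h < 3)%N ->
  plane p g = plane p h -> g = h.
Proof.
move=> Zp g3 h3 E; have [gh|gh|//] := ltngtP g h.
  by case: (@plane_neq _ _ p g h Zp); rewrite ?gh.
by case: (@plane_neq _ _ p h g Zp); rewrite ?gh.
Qed.

(** Reduces critical planes to the three coordinate planes, so that distinctness of those planes
    decides all incidence questions. *)
Lemma criticalE k (p : mpoint R k) W : Z k p -> critical_plane p W <->
  exists i g, [/\ (g < 3)%N, present p g i & W = plane p g].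
Proof.
move=> Zp; split=> [[i [j [i0 ijk cp WE]]]|[i [g [g3 [i0 ik bg] ->]]]].
  have [g g3 bg] := born_ex Zp cp; exists i, g; split=> //.
    by split=> //; lia.
  by have [_ <-] := born_distr Zp bg.
exists i, (k - i)%N; have [cp <-] := born_distr Zp bg.
by split=> //; lia.
Qed.

Lemma present_vertical k (p : mpoint R k.+1) : present p 0 k.+1.
Proof. by split=> //; exact: born_birth. Qed.

Lemma verticalE k (p : mpoint R k.+1) : Z k.+1 p -> vertical p = plane p 0.
Proof. by move=> Zp; have [_ <-] := born_distr Zp (@born_birth _ _ p). Qed.

Lemma tangencyE k (p : mpoint R k.+1) g W : Z k.+1 p -> (0 < g < 3)%N ->
  [/\ critical_plane p W, W <> vertical p & W = plane p g] <->
  W = plane p g /\ exists i, present p g i.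
Proof.
move=> Zp /andP[g0 g3]; split=> [[/(criticalE W Zp)[i [h [h3 ph ->]]] _ E]|[-> [i pi]]].
  by split=> //; exists i; rewrite -(plane_inj Zp h3 g3 E).
split=> //; first by apply/criticalE => //; exists i, g.
by rewrite verticalE // => /(@plane_inj _ p g 0 Zp g3 isT) g00; rewrite g00 in g0.
Qed.

Lemma T1P k (p : mpoint R k.+1) W : Z k.+1 p ->
  is_T1 p W <-> W = plane p 1 /\ exists i, present p 1 i.
Proof. by move=> Zp; exact: (@tangencyE k p 1 W Zp isT). Qed.

Lemma T2P k (p : mpoint R k.+1) W : Z k.+1 p ->
  is_T2 p W <-> W = plane p 2 /\ exists i, present p 2 i.
Proof. by move=> Zp; exact: (@tangencyE k p 2 W Zp isT). Qed.

Lemma present_T1_eq k (p : mpoint R k.+1) i j : Z k.+1 p -> present p 1 i ->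
  (i + j)%N = k.+1 -> T1_eq p i j.
Proof.
move=> Zp pi ijk; exists (plane p 1); first by apply/T1P => //; split=> //; exists i.
by case: pi => i0 _ /(born_distr Zp)[cp <-].
Qed.

Lemma present_T2_eq k (p : mpoint R k.+1) i j : Z k.+1 p -> present p 2 i ->
  (i + j)%N = k.+1 -> T2_eq p i j.
Proof.
move=> Zp pi ijk; exists (plane p 2); first by apply/T2P => //; split=> //; exists i.
by case: pi => i0 _ /(born_distr Zp)[cp <-].
Qed.

(* [base_pt], with a type in which the level [k] is not hidden by unfolding [mdim]. *)
Definition below k (p : mpoint R k.+1) : mpoint R k := base_pt p.

Local Notation sub p g := (line_of p `<=` plane (below p) g).

Lemma pivot_sub k (p : mpoint R k.+1) : Z k.+1 p -> pivot p =
  if `[< sub p 0 >] then if `[< sub p 1 >] then 2 else 1 else 0.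
Proof.
move=> /chart_surj[y pE].
have sE g : `[< sub p g >] =
    (coef_pivot g (coef_f (pivot p) 1 (y k.*2.+3) (y k.*2.+4))
      (coef_u (pivot p) 1 (y k.*2.+3) (y k.*2.+4))
      (coef_v (pivot p) 1 (y k.*2.+3) (y k.*2.+4)) == 0).
  by apply/asboolP/eqP => /(line_sub_plane g pE).
by rewrite !sE [LHS](pivot_chart pE) /= !if_neg; case: ifP.
Qed.

Lemma lineE k (p : mpoint R k.+1) g h : Z k.+1 p -> (g < h < 3)%N ->
  sub p g -> sub p h ->
  line_of p = plane (below p) g `&` plane (below p) h.
Proof.
move=> /chart_surj[y pE] gh sg sh.
have bE : below p = chart (below p) y.
  by rewrite /below -base_chart -pE.
have [n nE] : exists n, n = pivot p by exists (pivot p).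
apply/seteqP; split=> [X lX|X [/(plane_dir bE)[a [b [c [gE ->]]]]]].
  by split; [exact: sg|exact: sh].
move=> /(planeP h a b c bE) hE.
rewrite [in line_of _]pE; apply/line_of_chart.
(* The spanning vector has pivot component 1, so the multiplier of a vector on the line is its own
   pivot component. *)
exists (coef_pivot (pivot p) a b c); congr (dchart _ y _); apply/funext => i.
rewrite wfieldS /tdir /dir.
have := (line_sub_plane g pE).1 sg; have := (line_sub_plane h pE).1 sh.
move: (y k.*2.+3) (y k.*2.+4) => u v.
move: gh gE hE => /andP[gh h3]; rewrite -nE {nE sg sh}.
case: g gh => [|[|g]] gh; case: h gh h3 => [|[|[|h]]] //= _ _;
  case: n => [|[|n]] //= -> -> U V; 
  do ?[by move/eqP: U; rewrite oner_eq0|by move/eqP: V; rewrite oner_eq0];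
  rewrite ?U ?V; ring.
Qed.

Lemma present_step k (p : mpoint R k.+1) g i : present (below p) g i ->
  sub p g -> present p (next_pos (pivot p) g) i.
Proof.
move=> [i0 ik bg] sg; split=> //; first exact: leqW.
by apply: born_step => // iE; rewrite iE ltnn in ik.
Qed.

Lemma code_size k (p : mpoint R k) w : RVT_code p w -> size w = k.
Proof.
elim: k p w => [|k IHk] p w /=; first by move=> ->.
by case=> w' [a [-> /IHk sw _]]; rewrite size_rcons sw.
Qed.

Lemma code_rcons k (p : mpoint R k.+1) w a : RVT_code p (rcons w a) ->
  RVT_code (below p) w /\
  if k is 0 then a = lR else letter_at (below p) (line_of p) a.
Proof. by move=> /= [w' [a' [/rcons_inj[-> ->]]]]. Qed.

(** The pivot component of the line is 1, and the plane of that position would force it to be 0. *)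
Lemma sub_not_all k (p : mpoint R k.+1) : Z k.+1 p ->
  sub p 1 -> sub p 2 -> ~ sub p 0.
Proof.
move=> /chart_surj[y pE] s1 s2 s0.
have := (line_sub_plane 0 pE).1 s0; have := (line_sub_plane 1 pE).1 s1.
have := (line_sub_plane 2 pE).1 s2; move: (y k.*2.+3) (y k.*2.+4) => u v.
case: (pivot p) => [|[|n]] /= E2 E1 E0.
- by move/eqP: E0; rewrite oner_eq0.
- by move/eqP: E1; rewrite oner_eq0.
- by move/eqP: E2; rewrite oner_eq0.
Qed.

Lemma present_V k (p : mpoint R k.+2) : Z k.+2 p -> sub p 0 -> present p 1 k.+1.
Proof.
move=> Zp s0; have := present_step (@present_vertical k (below p)) s0.
by rewrite pivot_sub // asboolT //; case: ifP.
Qed.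

Lemma present_T1 k (p : mpoint R k.+1) i : Z k.+1 p -> sub p 1 -> ~ sub p 0 ->
  present (below p) 1 i -> present p 1 i.
Proof.
by move=> Zp s1 s0 /present_step /(_ s1); rewrite pivot_sub // asboolF.
Qed.

Lemma present_L1 k (p : mpoint R k.+1) i : Z k.+1 p -> sub p 0 -> sub p 1 ->
  present (below p) 1 i -> present p 2 i.
Proof.
by move=> Zp s0 s1 /present_step /(_ s1); rewrite pivot_sub // !asboolT.
Qed.

Lemma present_T2 k (p : mpoint R k.+1) i : sub p 2 ->
  present (below p) 2 i -> present p 2 i.
Proof. by move=> s2 /present_step /(_ s2); case: (pivot p) => [|[|s]]. Qed.

Lemma is_L1I k (p : mpoint R k.+2) i : Z k.+2 p -> sub p 0 -> sub p 1 ->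
  present (below p) 1 i -> is_L1 (below p) (line_of p).
Proof.
move=> Zp s0 s1 pi; exists (plane (below p) 1).
  by apply/T1P; [exact: Z_base|split=> //; exists i].
by rewrite verticalE; [exact: (@lineE k.+1 p 0 1)|exact: Z_base].
Qed.

Lemma is_L2I k (p : mpoint R k.+2) i j : Z k.+2 p -> sub p 1 -> sub p 2 ->
  present (below p) 1 i -> present (below p) 2 j ->
  is_L2 (below p) (line_of p).
Proof.
move=> Zp s1 s2 pi pj; exists (plane (below p) 1), (plane (below p) 2).
split; last exact: (@lineE k.+1 p 1 2).
  by apply/T1P; [exact: Z_base|split=> //; exists i].
by apply/T2P; [exact: Z_base|split=> //; exists j].
Qed.

Lemma is_L3I k (p : mpoint R k.+2) i : Z k.+2 p -> sub p 0 -> sub p 2 ->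
  present (below p) 2 i -> is_L3 (below p) (line_of p).
Proof.
move=> Zp s0 s2 pi; exists (plane (below p) 2).
  by apply/T2P; [exact: Z_base|split=> //; exists i].
by rewrite verticalE; [exact: (@lineE k.+1 p 0 2)|exact: Z_base].
Qed.

(** * Effect of each letter on the tangency planes *)

Lemma step_V k (p : mpoint R k.+1) w : Z k.+1 p ->
  RVT_code p (rcons w lV) -> present p 1 k.
Proof.
case: k p => [|k] p Zp /code_rcons[_] //= [_ _ l0].
by apply: present_V => //; rewrite -verticalE //; exact: Z_base.
Qed.

(** A line also in the vertical plane would have the letter [lL1]; so df_k is nonzero on it, and T_1
    remains T_1. *)
Lemma step_T1 k (p : mpoint R k.+1) w i : Z k.+1 p ->
  RVT_code p (rcons w lT1) -> present (below p) 1 i -> present p 1 i.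
Proof.
case: k p => [|k] p Zp /code_rcons[_] //= [_ nL [T /(T1P _ (Z_base Zp))[-> _] s1]] pi.
apply: present_T1 => // s0; apply: nL; left; exact: is_L1I pi.
Qed.

(** Both planes containing the line shift by one place: the vertical plane becomes T_1 and the old
    T_1 becomes T_2. *)
Lemma step_L1 k (p : mpoint R k.+1) w : Z k.+1 p ->
  RVT_code p (rcons w lL1) -> present p 1 k /\
  forall i, present (below p) 1 i -> present p 2 i.
Proof.
case: k p => [|k] p Zp /code_rcons[_] //= [_ [T /(T1P _ (Z_base Zp))[-> _]]].
rewrite verticalE => [lE|]; last exact: Z_base.
have s0 : sub p 0 by rewrite lE => X [].
have s1 : sub p 1 by rewrite lE => X [].
by split=> [|i]; [exact: present_V|exact: present_L1].
Qed.

Lemma step_L2 k (p : mpoint R k.+1) w : Z k.+1 p ->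
  RVT_code p (rcons w lL2) ->
  [/\ exists i, present p 1 i, exists i, present p 2 i,
      forall i, present (below p) 1 i -> present p 1 i &
      forall i, present (below p) 2 i -> present p 2 i].
Proof.
case: k p => [|k] p Zp /code_rcons[_] //=.
move=> [_ [T [T' [/(T1P _ (Z_base Zp))[-> [i pi]] /(T2P _ (Z_base Zp))[-> [j pj]] lE]]]].
have s1 : sub p 1 by rewrite lE => X [].
have s2 : sub p 2 by rewrite lE => X [].
have s0 := sub_not_all Zp s1 s2.
have H1 l : present (below p) 1 l -> present p 1 l by exact: present_T1.
have H2 l : present (below p) 2 l -> present p 2 l by exact: present_T2.
by split=> //; [exists i; exact: H1|exists j; exact: H2].
Qed.

Lemma step_L3 k (p : mpoint R k.+1) w : Z k.+1 p ->
  RVT_code p (rcons w lL3) ->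
  [/\ present p 1 k, exists i, present p 2 i &
      forall i, present (below p) 2 i -> present p 2 i].
Proof.
case: k p => [|k] p Zp /code_rcons[_] //= [_ [T /(T2P _ (Z_base Zp))[-> [i pi]]]].
rewrite verticalE => [lE|]; last exact: Z_base.
have s0 : sub p 0 by rewrite lE => X [].
have s2 : sub p 2 by rewrite lE => X [].
have H2 l : present (below p) 2 l -> present p 2 l by exact: present_T2.
by split=> //; [exact: present_V|exists i; exact: H2].
Qed.

(** A T_1 after this letter would not be newborn, since newborn planes are vertical. Traced one
    level down, it would come from V or T_1, putting the line on L_3 or L_2, or from T_2, which
    never turns into T_1. *)
Lemma step_T2 k (p : mpoint R k.+1) w : Z k.+1 p ->
  RVT_code p (rcons w lT2) ->
  [/\ forall i, ~ present p 1 i, exists i, present p 2 i &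
      forall i, present (below p) 2 i -> present p 2 i].
Proof.
case: k p => [|k] p Zp /code_rcons[_] //= [_ nL [T /(T2P _ (Z_base Zp))[-> [j pj]] s2]].
have H2 l : present (below p) 2 l -> present p 2 l by exact: present_T2.
split=> // [i [i0 ik bi]|]; last by exists j; exact: H2.
have [cp dE] := born_distr Zp bi.
have uniq g : (g < 3)%N -> born p i g -> g = 1%N.
  move=> g3 bg; apply: (@plane_inj _ p g 1 Zp g3 isT); rewrite -dE.
  by have [_ ->] := born_distr Zp bg.
have [iE|/eqP ik'] := eqVneq i k.+2.
  by have := uniq 0%N isT; rewrite iE => /(_ (@born_birth _ _ p)).
have [cb lb] := born_inv Zp ik' cp.
have [g g3 bg] := born_ex (Z_base Zp) cb; have sg := lb g bg.
have := uniq _ (next_lt _ _) (born_step ik' bg sg).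
have pg : present (below p) g i by split=> //; lia.
case: g g3 bg sg pg => [|[|[|g]]] // _ _ sg pg E.
- by apply: nL; right; right; exact: is_L3I pj.
- by apply: nL; right; left; exact: is_L2I pg pj.
- by move: E; case: (pivot p) => [|[|s]].
Qed.

(** * Birth levels read off the code *)

Lemma code_Z_step (w : seq letter) (a : letter) (P : forall k, mpoint R k -> Prop) :
  (forall k (p : mpoint R k.+1), Z k.+1 p -> RVT_code p (rcons w a) ->
     Z k (base_pt p) -> RVT_code (base_pt p) w -> size w = k -> P k.+1 p) ->
  forall k (p : mpoint R k), Z k p -> RVT_code p (rcons w a) -> P k p.
Proof.
move=> H [|k] p Zp cp; first by move: (code_size cp); rewrite size_rcons.
have [cb _] := code_rcons cp.
by apply: H => //; [exact: Z_base|exact: code_size cb].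
Qed.

(** Ranging over all points with code [w] makes the birth level a property of the word, which can be
    propagated one letter at a time. *)
Definition code_present (w : seq letter) (g i : nat) : Prop :=
  forall k (p : mpoint R k), Z k p -> RVT_code p w -> present p g i.

Lemma code_present_L1 w : code_present (rcons w lL1) 1 (size w).
Proof.
by apply: code_Z_step => k p Zp cp _ _ ->; have [] := step_L1 Zp cp.
Qed.

Lemma code_present_L3 w : code_present (rcons w lL3) 1 (size w).
Proof.
by apply: code_Z_step => k p Zp cp _ _ ->; have [] := step_L3 Zp cp.
Qed.

Lemma code_present_rcons_L1 w i : code_present w 1 i ->
  code_present (rcons w lL1) 2 i.
Proof.
move=> wi; apply: code_Z_step => k p Zp cp Zb cb _.
by have [_ H] := step_L1 Zp cp; apply: H; exact: wi.
Qed.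

Lemma code_present_rcons_L2 w g i : (0 < g < 3)%N -> code_present w g i ->
  code_present (rcons w lL2) g i.
Proof.
move=> gg wi; apply: code_Z_step => k p Zp cp Zb cb _.
have [_ _ H1 H2] := step_L2 Zp cp; have := wi _ _ Zb cb.
by case: g gg {wi} => [|[|[|g]]] //; [move=> _; exact: H1|move=> _; exact: H2].
Qed.

Lemma code_present_rcons_L3 w i : code_present w 2 i ->
  code_present (rcons w lL3) 2 i.
Proof.
move=> wi; apply: code_Z_step => k p Zp cp Zb cb _.
by have [_ _ H] := step_L3 Zp cp; apply: H; exact: wi.
Qed.

Lemma code_present_rcons_T2 w i : code_present w 2 i ->
  code_present (rcons w lT2) 2 i.
Proof.
move=> wi; apply: code_Z_step => k p Zp cp Zb cb _.
by have [_ _ H] := step_T2 Zp cp; apply: H; exact: wi.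
Qed.

(** The letter V stands at position [size w] + 1 and describes the line at level [size w], so the
    plane that becomes T_1 is the vertical plane of level [size w]. *)
Lemma code_present_VT w m : code_present (w ++ lV :: nseq m lT1) 1 (size w).
Proof.
elim: m => [|m IHm].
  by rewrite cats1; apply: code_Z_step => k p Zp cp _ _ ->; exact: step_V cp.
have -> : w ++ lV :: nseq m.+1 lT1 = rcons (w ++ lV :: nseq m lT1) lT1.
  by rewrite -[m.+1]addn1 nseqD -cats1 -catA cat_cons.
apply: code_Z_step => k p Zp cp Zb cb _; apply: step_T1 cp _ => //.
exact: IHm.
Qed.

Lemma code_present_VTL w m :
  code_present (rcons (w ++ lV :: nseq m lT1) lL1) 2 (size w).
Proof. by apply: code_present_rcons_L1; exact: code_present_VT. Qed.

(** The first [lL1] makes the vertical plane of level [size w] a T_1; the second makes it a T_2. *)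
Lemma code_present_LL w : code_present (rcons (rcons w lL1) lL1) 2 (size w).
Proof. by apply: code_present_rcons_L1; exact: code_present_L1. Qed.

Lemma code_T1_eq w k (p : mpoint R k) i j : code_present w 1 i -> Z k p ->
  RVT_code p w -> (i + j)%N = k -> T1_eq p i j.
Proof.
by move=> H; case: k p => [|k] p Zp cp ij; have [i0 ik bi] := H _ _ Zp cp;
  [lia|exact: present_T1_eq].
Qed.

Lemma code_T2_eq w k (p : mpoint R k) i j : code_present w 2 i -> Z k p ->
  RVT_code p w -> (i + j)%N = k -> T2_eq p i j.
Proof.
by move=> H; case: k p => [|k] p Zp cp ij; have [i0 ik bi] := H _ _ Zp cp;
  [lia|exact: present_T2_eq].
Qed.

Lemma three_planes k (p : mpoint R k.+1) : Z k.+1 p ->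
  (exists i, present p 1 i) -> (exists i, present p 2 i) ->
  exists T T', [/\ is_T1 p T, is_T2 p T' &
    forall W, critical_plane p W <-> [\/ W = vertical p, W = T | W = T']].
Proof.
move=> Zp e1 e2; exists (plane p 1), (plane p 2).
split; [exact/T1P|exact/T2P|move=> W].
rewrite criticalE // verticalE //; split=> [[i [g [g3 _ ->]]]|].
  by case: g g3 => [|[|[|g]]] //; [constructor 1|constructor 2|constructor 3].
move: e1 e2 => [i1 p1] [i2 p2] [->|->|->].
- by exists k.+1, 0%N; split=> //; exact: present_vertical.
- by exists i1, 1%N.
- by exists i2, 2%N.
Qed.

Lemma two_planes k (p : mpoint R k.+1) : Z k.+1 p ->
  (forall i, ~ present p 1 i) -> (exists i, present p 2 i) ->
  ~ (exists T, is_T1 p T) /\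
  exists2 T', is_T2 p T' &
    forall W, critical_plane p W <-> (W = vertical p \/ W = T').
Proof.
move=> Zp n1 e2; split; first by move=> [T /(T1P _ Zp)[_ [i /n1]]].
exists (plane p 2); first exact/T2P.
move=> W; rewrite criticalE // verticalE //; split=> [[i [g [g3 pg ->]]]|].
  by case: g g3 pg => [|[|[|g]]] // _ pg; [left|case: (n1 i)|right].
move: e2 => [i2 p2] [->|->].
- by exists k.+1, 0%N; split=> //; exact: present_vertical.
- by exists i2, 2%N.
Qed.

End Code.

(* Locates the letter of the code at which the tangency plane is born, leaving
   the arithmetic of its position. *)
Ltac birth T E S S0 :=
  apply: (T _ _ _ _ E); [do ?[apply: code_present_rcons_T2|apply: code_present_rcons_L3
                 |apply: code_present_rcons_L2 => //];
             first [exact: code_present_VTL|exact: code_present_LL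
                   |exact: code_present_L1|exact: code_present_L3]
            |rewrite ?size_rcons ?S ?S0; lia|lia].

Lemma cat2_rcons (T : Type) (s : seq T) x y :
  s ++ [:: x; y] = rcons (rcons s x) y.
Proof. by rewrite -!cats1 -catA. Qed.

Lemma cat3_rcons (T : Type) (s : seq T) x y z :
  s ++ [:: x; y; z] = rcons (rcons (rcons s x) y) z.
Proof. by rewrite -!cats1 -!catA. Qed.

Lemma cat4_rcons (T : Type) (s : seq T) x y z t :
  s ++ [:: x; y; z; t] = rcons (rcons (rcons (rcons s x) y) z) t.
Proof. by rewrite -!cats1 -!catA. Qed.

Theorem theorem2p3 (R : realType) (k : nat) (p : mpoint R k)
    (w : seq letter) (w0 : seq letter) (a : letter)
    (hp : carrier (monster R k) p)
    (hcode : RVT_code p w)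
    (hlast : w = rcons w0 a)
    (ha : a \in [:: lL2; lL3; lT2])
    (hfirst : a \notin w0) :
  (* the critical planes present *)
  (a = lL2 \/ a = lL3 ->
     exists T T', [/\ is_T1 p T, is_T2 p T' &
       forall W, critical_plane p W <-> [\/ W = vertical p, W = T | W = T']]) /\
  (a = lT2 ->
     ~ (exists T, is_T1 p T) /\
     exists2 T', is_T2 p T' &
       forall W, critical_plane p W <-> (W = vertical p \/ W = T')) /\
  (forall (r : nat) (w' : seq letter), size w' = r ->
     (* last letter L2 *)
     (forall m, w = lR :: w' ++ lV :: nseq m lT1 ++ [:: lL1; lL2] ->
        T1_eq p (m + 2 + r) 2 /\ T2_eq p (1 + r) (m + 3)) /\
     (w = lR :: w' ++ [:: lL1; lL1; lL2] ->
        T1_eq p (k - 2) 2 /\ T2_eq p (k - 3) 3) /\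
     (* last letter L3 *)
     (forall m, w = lR :: w' ++ lV :: nseq m lT1 ++ [:: lL1; lL3] ->
        T1_eq p (k - 1) 1 /\ T2_eq p (r + 1) (m + 3)) /\
     (w = lR :: w' ++ [:: lL1; lL1; lL3] ->
        T1_eq p (k - 1) 1 /\ T2_eq p (k - 3) 3) /\
     (forall m, w = lR :: w' ++ lV :: nseq m lT1 ++ [:: lL1; lT2; lL3] ->
        T1_eq p (k - 1) 1 /\ T2_eq p (r + 1) (m + 4)) /\
     (w = lR :: w' ++ [:: lL1; lL1; lT2; lL3] ->
        T1_eq p (k - 1) 1 /\ T2_eq p (k - 4) 4) /\
     (forall m,
        w = lR :: w' ++ lV :: nseq m lT1 ++ [:: lL1; lL2; lT2; lL3] ->
        T1_eq p (k - 1) 1 /\ T2_eq p (r + 1) (m + 5)) /\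
     (forall m s, 2 <= s ->
        w = lR :: w' ++ lV :: nseq m lT1 ++ nseq s lL1 ++ [:: lL2; lT2; lL3] ->
        T1_eq p (k - 1) 1 /\ T2_eq p (m + r + s) 5) /\
     (* last letter T2 *)
     (forall m, w = lR :: w' ++ lV :: nseq m lT1 ++ [:: lL1; lT2] ->
        T2_eq p (1 + r) (m + 3)) /\
     (w = lR :: w' ++ [:: lL1; lL1; lT2] ->
        T2_eq p (k - 3) 3) /\
     (forall m, w = lR :: w' ++ lV :: nseq m lT1 ++ [:: lL1; lL2; lT2] ->
        T2_eq p (r + 1) (m + 4)) /\
     (forall m s, 2 <= s ->
        w = lR :: w' ++ lV :: nseq m lT1 ++ nseq s lL1 ++ [:: lL2; lT2] ->
        T2_eq p (r + m + s) 4) /\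
     (forall m, w = lR :: w' ++ lV :: nseq m lT1 ++ [:: lL1; lL3; lT2] ->
        T2_eq p (r + 1) (m + 4)) /\
     (forall m s, 2 <= s ->
        w = lR :: w' ++ lV :: nseq m lT1 ++ nseq s lL1 ++ [:: lL3; lT2] ->
        T2_eq p (m + s + r) 4)).
Proof.
case: k p hp hcode => [|k] p hp hcode.
  by move: (code_size hcode); rewrite hlast size_rcons.
have wk := code_size hcode.
split=> [aL|].
  case: aL => aE; rewrite hlast aE in hcode.
    by have [e1 e2 _ _] := step_L2 hp hcode; exact: three_planes.
  have [p1 e2 _] := step_L3 hp hcode; apply: three_planes => //.
  (* After [lL3] the plane T_1 is the prolonged vertical plane of the preceding level. *)
  by exists k.
split=> [aE|r w' wr].
  rewrite hlast aE in hcode; have [n1 e2 _] := step_T2 hp hcode.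
  exact: two_planes.
have T1 x i' i j : w = x -> @code_present R x 1 i' -> i' = i ->
    i + j = k.+1 -> T1_eq p i j.
  by move=> wx xi <-; apply: (code_T1_eq xi hp); rewrite -wx.
have T2 x i' i j : w = x -> @code_present R x 2 i' -> i' = i ->
    i + j = k.+1 -> T2_eq p i j.
  by move=> wx xi <-; apply: (code_T2_eq xi hp); rewrite -wx.
have RE x : lR :: w' ++ x = (lR :: w') ++ x by [].
pose X m := (lR :: w') ++ lV :: nseq m lT1.
have XE m x : lR :: w' ++ lV :: nseq m lT1 ++ x = X m ++ x by rewrite /X -catA.
(* The last two letters [lL1] already fix both tangency planes; the other s - 2 join the prefix,
   whose size is then the birth level of T_2. *)
have XsE m s x : 1 < s -> lR :: w' ++ lV :: nseq m lT1 ++ nseq s lL1 ++ x =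
    rcons (rcons (X m ++ nseq (s - 2) lL1) lL1) lL1 ++ x.
  by move=> s2; rewrite XE -{1}(subnK s2) nseqD -cat2_rcons !catA.
have X0 : size (lR :: w') = r + 1 by rewrite /= wr addn1.
have Xm m : size (X m) = m + 2 + r by rewrite size_cat /= size_nseq wr; lia.
have Xs m s : 1 < s -> size (X m ++ nseq (s - 2) lL1) = m + s + r.
  by move=> s2; rewrite size_cat size_nseq Xm; lia.
have sizeE x : w = x -> size x = k.+1 by move=> <-.
split=> [m|].
  rewrite XE cat2_rcons => E; have := sizeE _ E; rewrite !size_rcons Xm => kE.
  by split; [birth T1 E Xm X0|birth T2 E Xm X0].
split.
  rewrite RE cat3_rcons => E; have := sizeE _ E; rewrite !size_rcons X0 => kE.
  by split; [birth T1 E X0 X0|birth T2 E X0 X0].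
split=> [m|].
  rewrite XE cat2_rcons => E; have := sizeE _ E; rewrite !size_rcons Xm => kE.
  by split; [birth T1 E Xm X0|birth T2 E Xm X0].
split.
  rewrite RE cat3_rcons => E; have := sizeE _ E; rewrite !size_rcons X0 => kE.
  by split; [birth T1 E X0 X0|birth T2 E X0 X0].
split=> [m|].
  rewrite XE cat3_rcons => E; have := sizeE _ E; rewrite !size_rcons Xm => kE.
  by split; [birth T1 E Xm X0|birth T2 E Xm X0].
split.
  rewrite RE cat4_rcons => E; have := sizeE _ E; rewrite !size_rcons X0 => kE.
  by split; [birth T1 E X0 X0|birth T2 E X0 X0].
split=> [m|].
  (* T_2 is the plane born at r + 1, before V: [lL1] makes it T_2 and the later letters keep it. The
     plane born at m + r + 2 is T_1 after [lL1] and [lL2] and disappears at [lT2]. *)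
  rewrite XE cat4_rcons => E; have := sizeE _ E; rewrite !size_rcons Xm => kE.
  by split; [birth T1 E Xm X0|birth T2 E Xm X0].
split=> [m s s2|].
  (* Here T_2 is born just before the last but one [lL1], at level m + s + r, and the five letters
     from there on give five prolongations. *)
  rewrite XsE // cat3_rcons => E; have := sizeE _ E; rewrite !size_rcons Xs // => kE.
  by split; [birth T1 E (Xs m s s2) X0|birth T2 E (Xs m s s2) X0].
split=> [m|].
  rewrite XE cat2_rcons => E; have := sizeE _ E; rewrite !size_rcons Xm => kE.
  by birth T2 E Xm X0.
split.
  rewrite RE cat3_rcons => E; have := sizeE _ E; rewrite !size_rcons X0 => kE.
  by birth T2 E X0 X0.
split=> [m|].
  rewrite XE cat3_rcons => E; have := sizeE _ E; rewrite !size_rcons Xm => kE.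
  by birth T2 E Xm X0.
split=> [m s s2|].
  rewrite XsE // cat2_rcons => E; have := sizeE _ E; rewrite !size_rcons Xs // => kE.
  by birth T2 E (Xs m s s2) X0.
split=> [m|m s s2].
  (* [lL3] replaces T_1 but keeps T_2, so the plane born just before V survives as T_2. *)
  rewrite XE cat3_rcons => E; have := sizeE _ E; rewrite !size_rcons Xm => kE.
  by birth T2 E Xm X0.
rewrite XsE // cat2_rcons => E; have := sizeE _ E; rewrite !size_rcons Xs // => kE.
by birth T2 E (Xs m s s2) X0.
Qed.
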